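(* Let $\ell\ge2$ and let $\mathcal R$ be a merging $\ell$-vertex rule. If $\mathcal R$ is locally convergent, with limiting functions $\rho_k=\rho_k^{\mathcal R}$, then $\mathcal R$ is globally convergent, and the limiting function $\rho=\rho^{\mathcal R}$ is continuous on $[0,\infty)$ and satisfies $\rho(t)=1-\sum_{k\ge1}\rho_k(t)$ for all $t\ge0$.
   Context: $\ell$-vertex rule: fix an integer $\ell\ge2$. For each $n$, let $(\underline v_1,\underline v_2,\dots)$ be an i.i.d. sequence, where each $\underline v_m=(v_{m,1},\dots,v_{m,\ell})$ consists of $\ell$ vertices of $[n]$ chosen independently and uniformly at random. There is a filtration $\mathcal F_0\subseteq\mathcal F_1\subseteq\cdots$ such that $\underline v_m$ is $\mathcal F_m$-measurable and independent of $\mathcal F_{m-1}$. An $\ell$-vertex rule is, for each $n$, a random sequence of graphs $(G(m))_{m\ge0}=(G_n^{\mathcal R}(m))$ on $[n]$ such that: (i) $G(0)$ is empty; (ii) for $m\ge1$, $G(m)=G(m-1)\cup E_m$ where $E_m$ is a (possibly empty) $\mathcal F_m$-measurable set of edges each joining two vertices of $\underline v_m$; (iii) if the $\ell$ vertices of $\underline v_m$ lie in $\ell$ distinct components of $G(m-1)$, then $E_m\ne\varnothing$. Merging: for every $\varepsilon>0$, $n$, $m\ge1$, whenever $C,C'$ are distinct components of $G(m-1)$ with $|C|,|C'|\ge\varepsilon n$, conditional on $\mathcal F_{m-1}$ the probability that $C$ and $C'$ lie in the same component of $G(m)$ is at least $\varepsilon^\ell$. Notation: $N_k(m)$ is the number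 of vertices of $G(m)$ in components with exactly $k$ vertices; $L_1(m)$ is the number of vertices in a largest component of $G(m)$; $\xrightarrow{p}$ denotes convergence in probability as $n\to\infty$. Local convergence: there exist functions $\rho_k:[0,\infty)\to[0,1]$ such that for each fixed integer $k\ge1$ and real $t\ge0$, $N_k(\lfloor tn\rfloor)/n\xrightarrow{p}\rho_k(t)$. Global convergence: there exists an increasing function $\rho:[0,\infty)\to[0,1]$ such that for every $t$ at which $\rho$ is continuous, $L_1(\lfloor tn\rfloor)/n\xrightarrow{p}\rho(t)$. *)

(* Defs.v *)
From HB Require Import structures.
From mathcomp Require Import all_boot all_order all_algebra.
From mathcomp Require Import all_classical all_reals all_analysis.
Set Implicit Arguments. Unset Strict Implicit. Unset Printing Implicit Defensive.
Import Order.TTheory GRing.Theory Num.Theory.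
Import numFieldNormedType.Exports.
Local Open Scope classical_set_scope.
Local Open Scope ring_scope.

(** Graphs on the vertex set 'I_N are represented by their edge sets
    (sets of ordered pairs, read as undirected edges). *)
Section Graphs.
Variable N : nat.
Implicit Types (g : {set 'I_N * 'I_N}) (x y : 'I_N).

Definition gadj g : rel 'I_N := fun x y => ((x, y) \in g) || ((y, x) \in g).
Definition gconn g x y : bool := connect (gadj g) x y.
Definition gcomp g x : {set 'I_N} := [set y | gconn g x y].
Definition is_component g (S : {set 'I_N}) : Prop := exists x, S = gcomp g x.
Definition same_comp g (S S' : {set 'I_N}) : bool :=
  [exists x in S, exists y in S', gconn g x y].
Definition Nk g (k : nat) : nat := #|[set x | #|gcomp g x| == k]|.
Definition L1 g : nat := \max_(x : 'I_N) #|gcomp g x|.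
End Graphs.

Definition Gproc (N : nat) (T : Type) (E : nat -> T -> {set 'I_N * 'I_N})
  (m : nat) (w : T) : {set 'I_N * 'I_N} := \bigcup_(i < m) E i.+1 w.

Definition floorn {R : realType} (t : R) (N : nat) : nat := Num.truncn (t * N%:R).

Definition cvg_in_prob {R : realType} (d : measure_display)
  (T : nat -> measurableType d) (P : forall n, probability (T n) R)
  (X : forall n, T n -> R) (c : R) : Prop :=
  forall e : R, 0 < e ->
    (fun n => P n [set w | e < `|X n w - c|]) @ \oo --> 0%E.

(** An l-vertex rule, for every number of vertices (here n.+1).
    T n, P n : the probability space for the graph on n.+1 vertices;
    F n m : the filtration; v n m : the l-tuple \underline v_m (m >= 1);
    E n m : the edge set added at step m (m >= 1). *)
Definition is_vertex_rule {R : realType} (l : nat) (d : measure_display)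
  (T : nat -> measurableType d) (P : forall n, probability (T n) R)
  (F : forall n, nat -> set (set (T n)))
  (v : forall n, nat -> T n -> {ffun 'I_l -> 'I_n.+1})
  (E : forall n, nat -> T n -> {set 'I_n.+1 * 'I_n.+1}) : Prop :=
  (forall n m, sigma_algebra setT (F n m)) /\
  (forall n m, F n m `<=` measurable) /\
  (forall n m, F n m `<=` F n m.+1) /\
  (forall n m x, (1 <= m)%N -> F n m [set w | v n m w = x]) /\
  (* v_m is uniform on [n]^l and independent of F_{m-1}
     (this gives an i.i.d. sequence of l independent uniform vertices) *)
  (forall n m A x, (1 <= m)%N -> F n m.-1 A ->
     P n (A `&` [set w | v n m w = x]) =
     (P n A * ((n.+1 ^ l)%:R^-1)%:E)%E) /\
  (forall n m X, (1 <= m)%N -> F n m [set w | E n m w = X]) /\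
  (forall n m w a b, (1 <= m)%N -> (a, b) \in E n m w ->
     [/\ a != b, a \in codom (v n m w) & b \in codom (v n m w)]) /\
  (forall n m w, (1 <= m)%N ->
     (forall i j : 'I_l, i != j ->
        ~~ gconn (Gproc (E n) m.-1 w) (v n m w i) (v n m w j)) ->
     E n m w != finset.set0).

(** The merging property (conditional probability given F_{m-1} expressed
    through all events A of F_{m-1} on which C, C' are components). *)
Definition is_merging {R : realType} (l : nat) (d : measure_display)
  (T : nat -> measurableType d) (P : forall n, probability (T n) R)
  (F : forall n, nat -> set (set (T n)))
  (E : forall n, nat -> T n -> {set 'I_n.+1 * 'I_n.+1}) : Prop :=
  forall (eps : R), 0 < eps -> forall n m, (1 <= m)%N ->
  forall C C' : {set 'I_n.+1}, C != C' ->
    eps * n.+1%:R <= #|C|%:R -> eps * n.+1%:R <= #|C'|%:R ->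
  forall A, F n m.-1 A ->
    A `<=` [set w | is_component (Gproc (E n) m.-1 w) C /\
                    is_component (Gproc (E n) m.-1 w) C'] ->
    ((eps ^+ l)%:E * P n A <=
       P n (A `&` [set w | same_comp (Gproc (E n) m w) C C']))%E.

Definition locally_convergent {R : realType} (d : measure_display)
  (T : nat -> measurableType d) (P : forall n, probability (T n) R)
  (E : forall n, nat -> T n -> {set 'I_n.+1 * 'I_n.+1})
  (rho : nat -> R -> R) : Prop :=
  (forall k t, 0 <= t -> 0 <= rho k t <= 1) /\
  (forall k t, (1 <= k)%N -> 0 <= t ->
     cvg_in_prob P
       (fun n w => (Nk (Gproc (E n) (floorn t n.+1) w) k)%:R / n.+1%:R)
       (rho k t)).

Definition globally_convergent_to {R : realType} (d : measure_display)
  (T : nat -> measurableType d) (P : forall n, probability (T n) R)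
  (E : forall n, nat -> T n -> {set 'I_n.+1 * 'I_n.+1})
  (rho : R -> R) : Prop :=
  (forall t, 0 <= t -> 0 <= rho t <= 1) /\
  (forall s t, 0 <= s -> s <= t -> rho s <= rho t) /\
  (forall t : R, 0 <= t ->
     rho x @[x --> within [set x : R | 0 <= x] (nbhs t)] --> rho t ->
     cvg_in_prob P
       (fun n w => (L1 (Gproc (E n) (floorn t n.+1) w))%:R / n.+1%:R)
       (rho t)).

(* Main.v *)
(** Let [S_K(t)] be the limiting proportion of vertices in components of fewer than [K] vertices
    and [rho = 1 - lim_K S_K].  Adding an edge changes only a few small components, so [S_K] is
    Lipschitz and non-increasing, and [rho] is non-decreasing and right-continuous.

    Grouping.  If many vertices lie in components of size at least [k] at time [t], then [C n / k]
    steps later almost all of them lie in components of linear size: otherwise these at most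
    [n / k] components could be coloured with [l] colours, each used on linearly many vertices,
    without any edge between colours.  Each step destroys a given such colouring with probability
    bounded below, and there are only [(l + 1)^(n / k)] of them.

    Left continuity.  If [rho] jumped at [t], then by grouping, at time [t - 2 C / k] the mass of
    the jump would sit in components of fewer than [k] vertices, and by the Lipschitz bound in
    components of at least [k / B] vertices.  A component of size [k] is untouched during
    [O(n / k)] steps with probability bounded below, so at time [t] every scale
    [[k / B, k)] would carry a mass bounded below, contradicting the convergence of [S_K(t)].

    Global convergence.  [L1 / n <= rho + o(1)] is immediate.  Conversely, grouping puts
    [rho(t) n] vertices in components of linear size at time [t + o(1)], the merging property
    joins all of those within [o(n)] further steps, and [rho] is left-continuous. *)

Require Import Defs.
From HB Require Import structures.
From mathcomp Require Import all_boot all_order all_algebra.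
From mathcomp Require Import all_classical all_reals all_analysis.
From mathcomp Require Import zify ring lra.
Set Implicit Arguments. Unset Strict Implicit. Unset Printing Implicit Defensive.
Import Order.TTheory GRing.Theory Num.Theory.
Import numFieldNormedType.Exports.

(** * Components of a growing graph *)

Section GraphComponents.
Import mathcomp.boot.fintype mathcomp.boot.finset.
Variable N : nat.
Implicit Types (g h X : {set 'I_N * 'I_N}) (x y : 'I_N) (U V W Z : {set 'I_N}).

Definition small g K : nat := #|[set x | #|gcomp g x| < K]|.

Definition gclosed g Z := forall x y, gconn g x y -> (x \in Z) = (y \in Z).

Lemma gadj_sym g : symmetric (gadj g).
Proof. by move=> x y; rewrite /gadj orbC. Qed.

Lemma gconn_refl g x : gconn g x x.
Proof. exact: connect0. Qed.

Lemma gconn_sym g x y : gconn g x y = gconn g y x.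
Proof. exact: (sym_connect_sym (gadj_sym g)). Qed.

Lemma gconn_trans g x y z : gconn g x y -> gconn g y z -> gconn g x z.
Proof. exact: connect_trans. Qed.

Lemma gconnS g h x y : g \subset h -> gconn g x y -> gconn h x y.
Proof.
move=> /subsetP gh; apply: connect_sub => a b ab; apply: connect1.
by case/orP: ab => /gh ab; rewrite /gadj ab ?orbT.
Qed.

Lemma mem_gcomp g x y : (y \in gcomp g x) = gconn g x y.
Proof. by rewrite inE. Qed.

Lemma gcomp_refl g x : x \in gcomp g x.
Proof. by rewrite mem_gcomp gconn_refl. Qed.

Lemma gcomp_eq g x y : gconn g x y -> gcomp g x = gcomp g y.
Proof.
move=> xy; apply/setP => z; rewrite !mem_gcomp; apply/idP/idP; apply: gconn_trans => //.
by rewrite gconn_sym.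
Qed.

Lemma gcompS g h x : g \subset h -> gcomp g x \subset gcomp h x.
Proof. by move=> gh; apply/subsetP => y; rewrite !mem_gcomp; apply: gconnS. Qed.

Lemma gcomp_sub g Z x : gclosed g Z -> x \in Z -> gcomp g x \subset Z.
Proof. by move=> cZ xZ; apply/subsetP => y; rewrite mem_gcomp => /cZ <-. Qed.

Lemma gclosed_gcomp g x : gclosed g (gcomp g x).
Proof.
move=> y z yz; rewrite !mem_gcomp; apply/idP/idP => xy; first exact: gconn_trans yz.
by rewrite gconn_sym in yz; exact: gconn_trans yz.
Qed.

Lemma gclosedD g Z U : gclosed g Z -> gclosed g U -> gclosed g (Z :\: U).
Proof. by move=> cZ cU x y xy; rewrite !inE (cZ _ _ xy) (cU _ _ xy). Qed.

Lemma gclosed_card g (p : pred nat) : gclosed g [set x | p #|gcomp g x|].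
Proof. by move=> x y xy; rewrite !inE (gcomp_eq xy). Qed.

(** No new edge has an endpoint in the component of [x], so this component is still closed under
    adjacency once [X] is added. *)
Lemma gcomp_untouched g X V x :
  (forall a b, (a, b) \in X -> a \in V /\ b \in V) ->
  (forall y, y \in V -> ~~ gconn g x y) -> gcomp (g :|: X) x = gcomp g x.
Proof.
move=> XV xV; apply/eqP; rewrite eqEsubset (gcompS _ (subsetUl _ _)) andbT.
apply/subsetP => y; rewrite mem_gcomp => xy.
suff cl : fingraph.closed (gadj (g :|: X)) (mem (gcomp g x)).
  by rewrite -(closed_connect cl xy) gcomp_refl.
have nX a b : (a, b) \in X -> (a \in gcomp g x) = (b \in gcomp g x).
  by move=> /XV[/xV/negbTE aV /xV/negbTE bV]; rewrite !mem_gcomp aV bV.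
move=> a b; rewrite /gadj !in_setU => ab.
have gab : ((a, b) \in g) || ((b, a) \in g) -> (a \in gcomp g x) = (b \in gcomp g x).
  by move=> e; apply: (gclosed_gcomp x); apply: connect1.
case/orP: ab => /orP[] e.
- by apply: gab; rewrite e.
- exact: nX.
- by apply: gab; rewrite e orbT.
- by apply: esym; apply: nX.
Qed.

Lemma small_le g K : small g K <= N.
Proof. by rewrite -[X in _ <= X](card_ord N); apply: max_card. Qed.

Lemma smallS g h K : g \subset h -> small h K <= small g K.
Proof.
move=> gh; apply: subset_leq_card; apply/subsetP => x; rewrite !inE.
by apply: leq_ltn_trans; apply: subset_leq_card; apply: gcompS.
Qed.

Lemma small_leK g K K' : K <= K' -> small g K <= small g K'.
Proof.
move=> KK; apply: subset_leq_card; apply/subsetP => x; rewrite !inE.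
by move=> /leq_trans; apply.
Qed.

Lemma NkE g k : Nk g k = #|[set x | #|gcomp g x| == k]|.
Proof.
apply: eq_card => x; rewrite inE.
by apply/idP/idP => [/set_mem|?]; [|apply/mem_set].
Qed.

Lemma sum_Nk g K : \sum_(1 <= k < K) Nk g k = small g K.
Proof.
transitivity (\sum_(1 <= k < K) \sum_(x < N) (#|gcomp g x| == k : nat)).
  apply: eq_bigr => k _; rewrite NkE -sum1_card; under eq_bigl do rewrite inE.
  by rewrite big_mkcond /=; apply: eq_bigr => x _; case: eqP.
rewrite exchange_big /small -sum1_card /=; under [RHS]eq_bigl do rewrite inE.
rewrite [RHS]big_mkcond /=; apply: eq_bigr => x _.
(* A component contains its base vertex, so starting the sum at [1] omits nothing. *)
have c0 : 0 < #|gcomp g x| by apply/card_gt0P; exists x; exact: gcomp_refl.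
transitivity (\sum_(1 <= k < K | k == #|gcomp g x|) 1).
  by rewrite [RHS]big_mkcond /=; apply: eq_bigr => k _; rewrite eq_sym; case: eqP.
by rewrite big_nat1_eq c0.
Qed.

(** A vertex can leave the small components only if its component meets [V]; at most [#|V|]
    components do, and the small ones among them have fewer than [K] vertices each. *)
Lemma small_step g X V K :
  (forall a b, (a, b) \in X -> a \in V /\ b \in V) ->
  small g K <= small (g :|: X) K + #|V| * K.
Proof.
move=> XV.
set A := [set x | #|gcomp g x| < K].
set B := [set x | #|gcomp (g :|: X) x| < K].
have sub : A \subset B :|: \bigcup_(y in V | #|gcomp g y| < K) gcomp g y.
  apply/subsetP => x; rewrite !inE => xK; apply/orP.
  have [/existsP[y /andP[yV xy]]|/existsPn none] := boolP [exists y, (y \in V) && gconn g x y].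
    right; apply/bigcupP; exists y; first by rewrite yV -(gcomp_eq xy).
    by rewrite mem_gcomp gconn_sym.
  left; rewrite (gcomp_untouched XV) // => y yV.
  by have := none y; rewrite yV.
apply: leq_trans (subset_leq_card sub) _.
apply: leq_trans (leq_card_setU _ _) _; rewrite leq_add2l.
apply: (@leq_trans (\sum_(y in V | #|gcomp g y| < K) #|gcomp g y|)).
  apply: (big_ind2 (fun (D : {set 'I_N}) n => #|D| <= n)) => //; first by rewrite cards0.
  by move=> D1 n1 D2 n2 h1 h2; apply: leq_trans (leq_card_setU _ _) (leq_add h1 h2).
apply: (@leq_trans (\sum_(y in V | #|gcomp g y| < K) K)).
  by apply: leq_sum => y /andP[_ /ltnW].
rewrite -sum_nat_const big_mkcondr /=.
by apply: leq_sum => y _; case: ifP.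
Qed.

(** * Colourings constant on components *)

Lemma minimal_closed_set g W Z q :
  gclosed g Z -> (forall x, x \in Z -> #|gcomp g x| <= q) -> q <= #|Z :&: W| ->
  exists U, [/\ gclosed g U, U \subset Z & q <= #|U :&: W| <= 2 * q].
Proof.
move: {2}#|Z|.+1 (ltnSn #|Z|) => b; elim: b Z => // b IH Z Zb cZ Zq qZ.
have [le2|gt2] := leqP #|Z :&: W| (2 * q).
  by exists Z; split=> //; rewrite qZ.
(* Discarding one component loses at most [q] vertices of [W], so the count cannot drop from above
   [2 * q] to below [q]. *)
have /card_gt0P[x] : 0 < #|Z :&: W| by apply: leq_ltn_trans gt2.
rewrite inE => /andP[xZ _].
have cC : gclosed g (gcomp g x) by exact: gclosed_gcomp.
have sub := gcomp_sub cZ xZ.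
have lt : #|Z :\: gcomp g x| < #|Z|.
  apply: proper_card; apply/properP; split; first exact: subsetDl.
  by exists x => //; rewrite inE gcomp_refl.
case: (IH (Z :\: gcomp g x)).
- exact: leq_trans lt Zb.
- exact: gclosedD.
- by move=> y; rewrite inE => /andP[_ /Zq].
- have := cardsID (gcomp g x) (Z :&: W).
  have : #|Z :&: W :&: gcomp g x| <= q.
    by apply: leq_trans (Zq _ xZ); apply: subset_leq_card; apply: subsetIr.
  have -> : (Z :&: W) :\: gcomp g x = (Z :\: gcomp g x) :&: W by rewrite setIDAC.
  lia.
move=> U [cU UZ qU]; exists U; split => //.
exact: subset_trans UZ (subsetDl _ _).
Qed.

(** Classes are split off one at a time as unions of components; each uses up at most [2 * q]
    vertices of [W], which is the budget assumed per colour. *)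
Lemma balanced_colouring g W Z q l :
  gclosed g Z -> (forall x, x \in Z -> #|gcomp g x| <= q) -> 2 * q * l <= #|Z :&: W| ->
  exists f : 'I_N -> nat, (forall x y, gconn g x y -> f x = f y) /\
    forall i, i < l -> q <= #|[set x in Z :&: W | f x == i]|.
Proof.
elim: l Z => [|l IH] Z cZ Zq big; first by exists (fun=> 0).
have [|U [cU UZ /andP[qU U2q]]] := minimal_closed_set cZ Zq (W := W); first by nia.
case: (IH (Z :\: U)).
- exact: gclosedD.
- by move=> y; rewrite inE => /andP[_ /Zq].
- have := cardsID U (Z :&: W).
  have -> : Z :&: W :&: U = U :&: W by rewrite setIAC (setIidPr UZ).
  have -> : (Z :&: W) :\: U = (Z :\: U) :&: W by rewrite setIDAC.
  by move=> e; nia.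
move=> f [fc fq]; exists (fun x => if x \in U then l else f x); split=> [x y xy|i].
  by rewrite (cU _ _ xy) (fc _ _ xy).
rewrite ltnS leq_eqVlt => /orP[/eqP ->|il].
  apply: leq_trans qU _; apply: subset_leq_card; apply/subsetP => x.
  rewrite !inE => /andP[xU ->]; rewrite xU eqxx.
  by rewrite (subsetP UZ).
apply: leq_trans (fq _ il) _; apply: subset_leq_card; apply/subsetP => x.
rewrite !inE => /andP[/andP[/andP[xU xZ] xW] fx].
by rewrite xZ xW (negbTE xU).
Qed.

Definition big_comps g k := [set gcomp g x | x in [set x | k <= #|gcomp g x|]].

(** Distinct components are disjoint. This count becomes the exponent in the number of
    colourings. *)
Lemma card_big_comps g k : k * #|big_comps g k| <= N.
Proof.
have tI : trivIset (big_comps g k).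
  apply/trivIsetP => A B /imsetP[x _ ->] /imsetP[y _ ->].
  apply: contraNT; case/pred0Pn => z /=; rewrite !mem_gcomp => /andP[xz yz].
  by rewrite (gcomp_eq xz) (gcomp_eq yz).
rewrite mulnC -sum_nat_const; apply: (@leq_trans #|cover (big_comps g k)|).
  rewrite -(eqP tI); apply: leq_sum => A /imsetP[x]; rewrite inE => xk ->; exact: xk.
by rewrite -[X in _ <= X](card_ord N); apply: max_card.
Qed.

(** Colours are attached to the components of the earlier graph [g] rather than to vertices, so that
    few colourings have to be counted; [None] means uncoloured. *)
Definition colour_class l g (psi : {ffun {set 'I_N} -> option 'I_l}) (i : 'I_l) :=
  [set x | psi (gcomp g x) == Some i].

Definition unjoined l g (psi : {ffun {set 'I_N} -> option 'I_l}) h :=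
  [forall x, forall y, forall i, forall j,
    [&& x \in colour_class g psi i, y \in colour_class g psi j & gconn h x y] ==> (i == j)].

Lemma unjoinedP l g (psi : {ffun {set 'I_N} -> option 'I_l}) h :
  reflect (forall x y i j, x \in colour_class g psi i -> y \in colour_class g psi j ->
             gconn h x y -> i = j) (unjoined g psi h).
Proof.
apply: (iffP idP) => [/forallP sep x y i j xi yj xy|sep].
  apply/eqP; move/(_ x)/forallP/(_ y)/forallP/(_ i)/forallP/(_ j)/implyP: sep.
  by apply; rewrite xi yj xy.
apply/forallP => x; apply/forallP => y; apply/forallP => i; apply/forallP => j.
by apply/implyP => /and3P[xi yj xy]; apply/eqP; exact: sep xy.
Qed.

Lemma unjoinedS l g (psi : {ffun {set 'I_N} -> option 'I_l}) h h' :
  h \subset h' -> unjoined g psi h' -> unjoined g psi h.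
Proof.
move=> hh /unjoinedP sep; apply/unjoinedP => x y i j xi yj xy.
by apply: sep xi yj _; exact: gconnS hh xy.
Qed.

(** The components of [h] with at most [q] vertices receive a balanced colouring. Since [g] is
    contained in [h], the colour is constant on components of [g] and descends to [big_comps g k];
    different colours lie in different components of [h]. *)
Lemma separating_colouring l g h k q : g \subset h ->
  2 * q * l <= #|[set x | (k <= #|gcomp g x|) && (#|gcomp h x| <= q)]| ->
  exists2 psi : {ffun {set 'I_N} -> option 'I_l},
    psi \in pffun_on None (mem (big_comps g k)) predT &
    unjoined g psi h && [forall i, q <= #|colour_class g psi i|].
Proof.
move=> gh big.
set W := [set x | k <= #|gcomp g x|]; set Z := [set x | #|gcomp h x| <= q].
have cZ : gclosed h Z by apply: (@gclosed_card h (fun c => c <= q)).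
have cW : gclosed g W by apply: (@gclosed_card g (fun c => k <= c)).
have [||f [fc fq]] := @balanced_colouring h W Z q l cZ.
- by move=> x; rewrite inE.
- suff -> : Z :&: W = [set x | (k <= #|gcomp g x|) && (#|gcomp h x| <= q)] by [].
  by apply/setP => x; rewrite !inE andbC.
pose phi x : option 'I_l := if x \in Z then insub (f x) else None.
have phic x y : gconn g x y -> phi x = phi y.
  by move=> /(gconnS gh) xy; rewrite /phi (cZ _ _ xy) (fc _ _ xy).
(* The colour is read off at any vertex of the component; the value [None] outside [big_comps g k]
   keeps the family of possible [psi] small. *)
pose psi := [ffun D : {set 'I_N} => if D \in big_comps g k then
  if [pick x in D] is Some x then phi x else None else None].
have psiE x : psi (gcomp g x) = if x \in W then phi x else None.
  rewrite ffunE; have -> : (gcomp g x \in big_comps g k) = (x \in W).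
    apply/imsetP/idP => [[y yW]|xW]; last by exists x.
    by rewrite inE in yW; rewrite inE => ->.
  case: ifP => // _; case: pickP => [y|/(_ x)]; last by rewrite gcomp_refl.
  by rewrite mem_gcomp => /phic.
have psiS x i : (psi (gcomp g x) == Some i) = [&& x \in Z, x \in W & f x == i].
  rewrite psiE /phi; case: (x \in W); case: (x \in Z) => //=.
  case: insubP => [j _ <-|]; first by apply/eqP/eqP => [[->]|/val_inj ->].
  by move=> nl; apply/esym/negbTE; apply: contraNneq nl => ->.
exists psi.
  apply/pffun_onP; split => //; apply/supportP => D DN; rewrite ffunE.
  by rewrite (negbTE DN).
apply/andP; split.
  apply/unjoinedP => x y i j; rewrite !inE !psiS.
  move=> /and3P[_ _ /eqP xi] /and3P[_ _ /eqP yj] xy; apply: val_inj => /=.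
  by rewrite -xi -yj; exact: fc.
apply/forallP => i; apply: leq_trans (fq i (ltn_ord i)) _.
apply: subset_leq_card; apply/subsetP => x; rewrite !inE psiS !inE.
by case/andP=> /andP[-> ->] ->.
Qed.

Lemma gcomp_le_L1 g x : #|gcomp g x| <= L1 g.
Proof. exact: (leq_bigmax (F := fun x => #|gcomp g x|)). Qed.

(** A largest component with at least [K] vertices is disjoint from all components with fewer. *)
Lemma L1_small g K : K <= L1 g -> 0 < K -> L1 g + small g K <= N.
Proof.
move=> KL K0.
have [x Lx] : exists x, L1 g = #|gcomp g x|.
  have [x0|/card_gt0P[x _]] := posnP #|'I_N|.
    have : L1 g <= 0.
      apply/bigmax_leqP => i _; move: (ltn_ord i) x0; rewrite card_ord; lia.
    by move=> /(leq_trans KL)/(leq_trans K0).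
  have [|y Ly] := @bigop.eq_bigmax _ (fun x => #|gcomp g x|); last by exists y.
  by apply/card_gt0P; exists x.
have disj : [disjoint gcomp g x & [set y | #|gcomp g y| < K]].
  apply/pred0P => y /=; apply/negbTE; rewrite mem_gcomp inE negb_and -leqNgt.
  by have [/gcomp_eq <-|//] := boolP (gconn g x y); rewrite -Lx KL orbT.
rewrite Lx /small.
have := leq_card_setU (gcomp g x) [set y | #|gcomp g y| < K].
rewrite disj => -[_ /eqP <-].
by rewrite -[X in _ <= X](card_ord N); apply: max_card.
Qed.

Lemma gcomp0 x : gcomp finset.set0 x = [set x].
Proof.
apply/eqP; rewrite eqEsubset sub1set gcomp_refl andbT.
apply/subsetP => y; rewrite mem_gcomp inE.
have cl : fingraph.closed (gadj (N := N) finset.set0) (mem [set x]).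
  by move=> a b; rewrite /gadj !inE.
by move=> xy; have := closed_connect cl xy; rewrite !inE eqxx => <-.
Qed.

Lemma small0 K : 1 < K -> small finset.set0 K = N.
Proof.
move=> K1; rewrite /small -[RHS]card_ord; apply: eq_card => x.
by rewrite !inE gcomp0 cards1 K1.
Qed.

End GraphComponents.

Local Open Scope classical_set_scope.
Local Open Scope ring_scope.

(** * Finite probability calculus *)

Section RealProbability.
Variables (R : realType) (d : measure_display) (T : measurableType d).
Variable P : probability T R.
Implicit Types A B : set T.

Definition pr A : R := fine (P A).

Lemma prE A : measurable A -> P A = (pr A)%:E.
Proof. by move=> mA; rewrite /pr fineK // fin_num_measure. Qed.

Lemma pr_ge0 A : 0 <= pr A.
Proof. exact: fine_ge0. Qed.

Lemma pr_le1 A : measurable A -> pr A <= 1.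
Proof. by move=> mA; rewrite -lee_fin -prE // probability_le1. Qed.

Lemma pr_le A B : measurable A -> measurable B -> A `<=` B -> pr A <= pr B.
Proof. by move=> mA mB AB; rewrite -lee_fin -!prE // le_measure // inE. Qed.

Lemma pr0 : pr set0 = 0.
Proof. by rewrite /pr measure0. Qed.

Lemma prT : pr setT = 1.
Proof. by rewrite /pr probability_setT. Qed.

Lemma pr_split A B : measurable A -> measurable B ->
  pr A = pr (A `&` B) + pr (A `&` ~` B).
Proof.
move=> mA mB; apply: EFin_inj; rewrite EFinD -!prE //; last first.
- exact: measurableI.
- by apply: measurableI => //; apply: measurableC.
by rewrite (measureDI P mA mB) -setDE addeC.
Qed.

Lemma pr_setC A : measurable A -> pr (~` A) = 1 - pr A.
Proof.
by move=> mA; rewrite -prT (pr_split measurableT mA) !setTI addrAC subrr add0r.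
Qed.

Lemma pr_fibers (H : finType) (f : T -> H) A : measurable A ->
  (forall a, measurable [set w | f w = a]) ->
  pr A = \sum_a pr (A `&` [set w | f w = a]).
Proof.
move=> mA mf.
suff : forall s : seq H, uniq s ->
    measurable [set w | f w \in s] /\
    pr (A `&` [set w | f w \in s]) = \sum_(a <- s) pr (A `&` [set w | f w = a]).
  move=> /(_ (index_enum H) (index_enum_uniq H))[_ <-]; congr pr.
  by apply/seteqP; split => [w Aw|w []//]; split=> //=; rewrite mem_index_enum.
elim=> [_|a s IH /= /andP[as_ /IH[ms es]]].
  rewrite big_nil; have -> : [set w | f w \in [::]] = set0 by apply/seteqP; split.
  by rewrite setI0 pr0.
have eU : [set w | f w \in a :: s] = [set w | f w = a] `|` [set w | f w \in s].
  apply/seteqP; split=> w /=; rewrite inE; first by case/orP=> [/eqP|]; [left|right].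
  by case=> [->|->]; rewrite ?eqxx ?orbT.
have mU : measurable [set w | f w \in a :: s] by rewrite eU; apply: measurableU.
split=> //; rewrite big_cons -es (@pr_split _ [set w | f w = a]) //; last exact: measurableI.
congr (pr _ + pr _).
  by rewrite -setIA eU; congr (_ `&` _); rewrite setIC; apply/setIidPl; left.
rewrite -setIA eU; congr (_ `&` _); apply/seteqP; split=> w /=; first by case=> -[].
by move=> ws; split; [right|move=> wa; rewrite -wa ws in as_].
Qed.

Lemma pr_union_bound (I : eqType) (s : seq I) (B : I -> set T) A : measurable A ->
  (forall i, measurable (B i)) -> (forall w, A w -> exists2 i, i \in s & B i w) ->
  pr A <= \sum_(i <- s) pr (B i).
Proof.
move=> mA mB; elim: s A mA => [|i s IH] A mA AB.
  rewrite big_nil; have -> : A = set0; last by rewrite pr0.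
  by apply/seteqP; split=> // w /AB[].
rewrite big_cons (pr_split mA (mB i)); apply: lerD.
  by apply: pr_le => //; exact: measurableI.
apply: IH => [|w [Aw nB]]; first by apply: measurableI => //; apply: measurableC.
have [j] := AB _ Aw; rewrite inE => /orP[/eqP -> //|js Bj]; by exists j.
Qed.

End RealProbability.

Section ExpectedCount.
Variables (R : realType) (d : measure_display) (T : measurableType d).
Variable P : probability T R.
Variables (I H : finType) (f : T -> H) (Q : I -> pred H).
Hypothesis mf : forall D : pred H, measurable [set w | D (f w)].
Implicit Types A B : set T.

Let mfib a : measurable [set w | f w = a].
Proof.
have -> : [set w | f w = a] = [set w | f w == a] by apply/seteqP; split=> w /eqP.
exact: (mf (pred1 a)).
Qed.

(** Both sides are the expected number, on [A], of indices [x] with [Q x (f w)]. As [f] has finitely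
    many values, the expectation is a finite sum over its fibres. *)
Lemma sum_pr_fibers A : measurable A ->
  \sum_x pr P (A `&` [set w | Q x (f w)]) =
  \sum_a #|[pred x | Q x a]|%:R * pr P (A `&` [set w | f w = a]).
Proof.
move=> mA.
transitivity (\sum_x \sum_a (Q x a)%:R * pr P (A `&` [set w | f w = a])).
  apply: eq_bigr => x _.
  have mAQ : measurable (A `&` [set w | Q x (f w)]) by exact: measurableI.
  rewrite (pr_fibers P mAQ mfib); apply: eq_bigr => a _.
  have [Qa|nQ] := boolP (Q x a); rewrite ?mul1r ?mul0r.
    by congr (pr P _); apply/seteqP; split=> w /=; [case=> -[] | case=> Aw ->].
  rewrite (_ : _ `&` _ = set0) ?pr0 //; apply/seteqP; split=> // w /= [[_ +] fa].
  by rewrite fa (negbTE nQ).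
rewrite exchange_big; apply: eq_bigr => a _; rewrite -mulr_suml; congr (_ * _).
by rewrite -sum1_card natr_sum [RHS]big_mkcond; apply: eq_bigr => x _; rewrite inE; case: (Q x a).
Qed.

Lemma sum_pr_ge A (c : R) : measurable A ->
  (forall w, A w -> c <= #|[pred x | Q x (f w)]|%:R) ->
  c * pr P A <= \sum_x pr P [set w | Q x (f w)].
Proof.
move=> mA cA; apply: (@le_trans _ _ (\sum_x pr P (A `&` [set w | Q x (f w)]))); last first.
  by apply: ler_sum => x _; apply: pr_le => //; exact: measurableI.
rewrite sum_pr_fibers // (pr_fibers P mA mfib) mulr_sumr.
apply: ler_sum => a _; have [->|/set0P[w [Aw fa]]] := eqVneq (A `&` [set w | f w = a]) set0.
  by rewrite pr0 !mulr0.
by rewrite ler_wpM2r ?pr_ge0 //; move: (cA _ Aw); rewrite fa.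
Qed.

(** On [A] the count is at most [c]; off [A] it is at most [#|I|]. *)
Lemma sum_pr_le A (c : R) : measurable A -> 0 <= c ->
  (forall w, A w -> #|[pred x | Q x (f w)]|%:R <= c) ->
  \sum_x pr P [set w | Q x (f w)] <= c + #|I|%:R * (1 - pr P A).
Proof.
move=> mA c0 cA.
have -> : \sum_x pr P [set w | Q x (f w)] =
    \sum_x pr P (A `&` [set w | Q x (f w)]) + \sum_x pr P (~` A `&` [set w | Q x (f w)]).
  rewrite -big_split; apply: eq_bigr => x _ /=; rewrite (pr_split P (mf (Q x)) mA).
  by rewrite (setIC _ A) (setIC _ (~` A)).
apply: lerD.
  rewrite sum_pr_fibers //; apply: (@le_trans _ _ (\sum_a c * pr P (A `&` [set w | f w = a]))).
    apply: ler_sum => a _; have [->|/set0P[w [Aw fa]]] := eqVneq (A `&` [set w | f w = a]) set0.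
      by rewrite pr0 !mulr0.
    by rewrite ler_wpM2r ?pr_ge0 //; move: (cA _ Aw); rewrite fa.
  by rewrite -mulr_sumr -(pr_fibers P mA mfib) ler_piMr // pr_le1.
have mC : measurable (~` A) by exact: measurableC.
apply: (@le_trans _ _ (\sum_(x in I) pr P (~` A))).
  by apply: ler_sum => x _; apply: pr_le => //; exact: measurableI.
by rewrite sumr_const pr_setC // mulr_natl.
Qed.

End ExpectedCount.

(** * Events of probability tending to one *)

Section WithHighProbability.
Variables (R : realType) (d : measure_display) (T : nat -> measurableType d).
Variable P : forall n, probability (T n) R.
Implicit Types Q : forall n, T n -> Prop.

(* Inner approximation by measurable sets frees the calculus below from measurability side goals. *)
Definition whp Q := forall eta : R, 0 < eta -> \forall n \near \oo,
  exists A : set (T n), [/\ measurable A, A `<=` Q n & 1 - eta <= pr (P n) A].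

Lemma whp_and Q Q' : whp Q -> whp Q' -> whp (fun n w => Q n w /\ Q' n w).
Proof.
move=> hQ hQ' eta eta0; have e2 : 0 < eta / 2 by rewrite divr_gt0.
apply: filterS2 (hQ _ e2) (hQ' _ e2) => n [A [mA AQ pA]] [B [mB BQ pB]].
have mAB := measurableI _ _ mA mB.
exists (A `&` B); split=> //; first by move=> w [/AQ ? /BQ].
have := pr_split (P n) mA mB.
have : pr (P n) (A `&` ~` B) <= pr (P n) (~` B).
  by apply: pr_le => //; [apply: measurableI => // |]; exact: measurableC.
rewrite pr_setC //; lra.
Qed.

Lemma whp_impl Q Q' : (forall n w, Q n w -> Q' n w) -> whp Q -> whp Q'.
Proof.
move=> QQ' hQ eta /hQ; apply: filterS => n [A [mA AQ pA]].
by exists A; split=> // w /AQ /QQ'.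
Qed.

Lemma whp_near (Q : nat -> Prop) : (\forall n \near \oo, Q n) -> whp (fun n _ => Q n).
Proof.
move=> hQ eta eta0; apply: filterS hQ => n Qn; exists setT; split=> //.
by rewrite prT; lra.
Qed.

Lemma whp_sure Q : (forall n w, Q n w) -> whp Q.
Proof.
move=> hQ; apply: (whp_impl _ (whp_near (Q := fun=> True) _)) => //.
exact: filterE.
Qed.

(** An event of probability at least one half has a point. This is how inequalities between limits
    are extracted from inequalities between random graphs. *)
Lemma whp_const (Q : Prop) : whp (fun _ _ => Q) -> Q.
Proof.
move=> /(_ (1 / 2)); rewrite divr_gt0 // => /(_ isT) /filter_ex[n [A [mA AQ pA]]].
have [A0|/set0P[w /AQ//]] := eqVneq A set0.
by move: pA; rewrite A0 pr0; lra.
Qed.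

Lemma near_div_le (M eta : R) : 0 < eta -> \forall n \near \oo, M / n.+1%:R <= eta.
Proof.
move=> eta0; exists (Num.truncn (M / eta)).+1 => // n /= nM.
rewrite ler_pdivrMr ?ltr0n // mulrC -ler_pdivrMr //.
by rewrite (le_trans (ltW (truncnS_gt _))) // ler_nat ltnW.
Qed.

Lemma whp_not (B : forall n, set (T n)) (M : R) : (forall n, measurable (B n)) ->
  (\forall n \near \oo, pr (P n) (B n) <= M / n.+1%:R) -> whp (fun n w => ~ B n w).
Proof.
move=> mB hB eta eta0; apply: filterS2 hB (near_div_le M eta0) => n h1 h2.
have mBn := mB n; exists (~` B n); split=> //; first exact: measurableC.
by rewrite pr_setC // lerD2l lerN2 (le_trans h1 h2).
Qed.

Lemma cvg_in_prob_whp (X : forall n, T n -> R) c e :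
  (forall n, measurable [set w | e < `|X n w - c|]) -> 0 < e ->
  cvg_in_prob P X c -> whp (fun n w => `|X n w - c| <= e).
Proof.
move=> mX e0 /(_ e e0) /fine_cvgP[_ /cvgrPdist_le cX] eta /cX.
apply: filterS => n; have mXn := mX n; rewrite sub0r normrN ger0_norm ?pr_ge0 // => pX.
exists (~` [set w | e < `|X n w - c|]); split; [exact: measurableC| |].
  by move=> w /= /negP; rewrite -leNgt.
by rewrite pr_setC // lerD2l lerN2.
Qed.

Lemma whp_cvg_in_prob (X : forall n, T n -> R) c :
  (forall e n, measurable [set w | e < `|X n w - c|]) ->
  (forall e, 0 < e -> whp (fun n w => `|X n w - c| <= e)) -> cvg_in_prob P X c.
Proof.
move=> mX hX e e0.
have -> : (fun n => P n [set w | e < `|X n w - c|]) =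
          (fun n => (pr (P n) [set w | e < `|X n w - c|])%:E).
  by apply/funext => n; rewrite prE.
apply: cvg_EFin; first exact: nearW.
apply/cvgrPdist_le => eta eta0; apply: filterS (hX e e0 eta eta0) => n [A [mA AX pA]].
rewrite sub0r normrN ger0_norm ?pr_ge0 //=; have mXn := mX e n.
have : pr (P n) [set w | e < `|X n w - c|] <= pr (P n) (~` A).
  apply: pr_le => //; first exact: measurableC.
  by move=> w /= ew /AX; rewrite leNgt ew.
by rewrite pr_setC //; lra.
Qed.

End WithHighProbability.

(** * One-step estimates *)

Section VertexRuleProcess.
Variables (R : realType) (l : nat) (d : measure_display) (T : measurableType d).
Variables (P : probability T R) (n : nat) (F : nat -> set (set T)).
Variables (v : nat -> T -> {ffun 'I_l -> 'I_n.+1}).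
Variables (E : nat -> T -> {set 'I_n.+1 * 'I_n.+1}).
Hypothesis F_sigma : forall m, sigma_algebra setT (F m).
Hypothesis F_meas : forall m, F m `<=` measurable.
Hypothesis F_filt : forall m, F m `<=` F m.+1.
Hypothesis F_v : forall m x, (1 <= m)%N -> F m [set w | v m w = x].
Hypothesis v_unif : forall m A x, (1 <= m)%N -> F m.-1 A ->
  P (A `&` [set w | v m w = x]) = (P A * ((n.+1 ^ l)%:R^-1)%:E)%E.
Hypothesis F_E : forall m X, (1 <= m)%N -> F m [set w | E m w = X].
Hypothesis E_edges : forall m w a b, (1 <= m)%N -> (a, b) \in E m w ->
  [/\ a != b, a \in codom (v m w) & b \in codom (v m w)].
Hypothesis E_neq0 : forall m w, (1 <= m)%N ->
  (forall i j : 'I_l, i != j -> ~~ gconn (Gproc E m.-1 w) (v m w i) (v m w j)) ->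
  E m w != finset.set0.

Local Notation G := (Gproc E).
Local Notation N := (n.+1%:R : R).

(** * The filtration and the events determined by the graphs *)

Lemma filt_set0 m : F m set0.
Proof. by case: (F_sigma m). Qed.

Lemma filt_setC m A : F m A -> F m (~` A).
Proof. by case: (F_sigma m) => _ + _ FA => /(_ _ FA); rewrite setTD. Qed.

Lemma filt_setU m A B : F m A -> F m B -> F m (A `|` B).
Proof.
move=> FA FB; rewrite -bigcup2E; case: (F_sigma m) => F0 _; apply.
by case=> [|[|i]].
Qed.

Lemma filt_setI m A B : F m A -> F m B -> F m (A `&` B).
Proof.
move=> FA FB; rewrite -[A `&` B]setCK setCI.
by apply: filt_setC; apply: filt_setU; apply: filt_setC.
Qed.

Lemma filt_le m m' A : (m <= m')%N -> F m A -> F m' A.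
Proof.
move=> /subnK <-; elim: (m' - m)%N => // k IH FA; rewrite addSn.
by apply: F_filt; apply: IH.
Qed.

Lemma filt_fin (H : finType) (f : T -> H) m (Q : pred H) :
  (forall a, F m [set w | f w = a]) -> F m [set w | Q (f w)].
Proof.
move=> Ff.
suff : forall s : seq H, F m [set w | f w \in s].
  move=> /(_ [seq a <- enum H | Q a]); congr (F m _).
  by apply/seteqP; split=> w /=; rewrite mem_filter mem_enum inE andbT.
elim=> [|a s IH].
  have -> : [set w | f w \in [::]] = set0 by apply/seteqP; split.
  exact: filt_set0.
have -> : [set w | f w \in a :: s] = [set w | f w = a] `|` [set w | f w \in s].
  apply/seteqP; split=> w /=; rewrite inE; first by case/orP=> [/eqP|]; [left|right].
  by case=> [->|->]; rewrite ?eqxx ?orbT.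
exact: filt_setU.
Qed.

Lemma GprocS m w : G m.+1 w = (G m w :|: E m.+1 w)%SET.
Proof. by rewrite /Gproc big_ord_recr. Qed.

Lemma Gproc0 w : G 0 w = finset.set0.
Proof. by rewrite /Gproc big_ord0. Qed.

Lemma Gproc_sub m m' w : (m <= m')%N -> G m w \subset G m' w.
Proof.
move=> /subnK <-; elim: (m' - m)%N => [|k IH]; first exact: fintype.subxx.
by rewrite addSn GprocS; apply: fintype.subset_trans IH (finset.subsetUl _ _).
Qed.

Lemma filt_Gproc_eq m g : F m [set w | G m w = g].
Proof.
elim: m g => [|m IH] g.
  have [->|g0] := eqVneq g finset.set0.
    have -> : [set w | G 0 w = finset.set0] = ~` set0.
      by rewrite setC0; apply/seteqP; split=> // w _ /=; rewrite Gproc0.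
    by apply: filt_setC; apply: filt_set0.
  have -> : [set w | G 0 w = g] = set0.
    by apply/seteqP; split=> // w /=; rewrite Gproc0 => /esym/eqP; rewrite (negbTE g0).
  exact: filt_set0.
have -> : [set w | G m.+1 w = g] = [set w | (fun X => (X.1 :|: X.2)%SET == g) (G m w, E m.+1 w)].
  by apply/seteqP; split=> w /=; rewrite GprocS => /eqP.
apply: (filt_fin (f := fun w => (G m w, E m.+1 w))
  (fun X => (X.1 :|: X.2)%SET == g)) => -[X Y].
have -> : [set w | (G m w, E m.+1 w) = (X, Y)] = [set w | G m w = X] `&` [set w | E m.+1 w = Y].
  by apply/seteqP; split=> w /= [-> ->].
by apply: filt_setI; [apply: F_filt | apply: F_E].
Qed.

Lemma filt_Gproc m m' (Q : pred {set 'I_n.+1 * 'I_n.+1}) :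
  (m <= m')%N -> F m' [set w | Q (G m w)].
Proof. by move=> mm; apply: filt_le mm _; apply: filt_fin; exact: filt_Gproc_eq. Qed.

Lemma measurable_Gproc m (Q : pred {set 'I_n.+1 * 'I_n.+1}) :
  measurable [set w | Q (G m w)].
Proof. by apply: (F_meas (m := m)); apply: filt_Gproc. Qed.

Lemma measurable_next m (S : pred {ffun 'I_l -> 'I_n.+1}) :
  measurable [set w | S (v m.+1 w)].
Proof. by apply: (F_meas (m := m.+1)); apply: filt_fin => a; exact: F_v. Qed.

(** The hypothesis [v_unif] treats a single value of the tuple; summing over [S] gives independence
    from [F m] for every set of tuples. *)
Lemma pr_next m A (S : pred {ffun 'I_l -> 'I_n.+1}) : F m A ->
  pr P (A `&` [set w | S (v m.+1 w)]) = pr P A * #|S|%:R / N ^+ l.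
Proof.
move=> FA; have mA := F_meas FA.
rewrite (@pr_fibers _ _ _ _ _ (v m.+1)); last 2 first.
- by apply: measurableI => //; apply: measurable_next.
- by move=> a; apply: (F_meas (m := m.+1)); exact: F_v.
transitivity (\sum_(x | S x) pr P A / N ^+ l).
  rewrite [RHS]big_mkcond; apply: eq_bigr => x _; case: ifP => Sx.
    have -> : A `&` [set w | S (v m.+1 w)] `&` [set w | v m.+1 w = x] = A `&` [set w | v m.+1 w = x].
      by apply/seteqP; split=> w /=; [case=> -[] | case=> Aw ->].
    by rewrite /pr v_unif //= fineM ?fin_num_measure //= natrX.
  rewrite (_ : _ `&` _ = set0) ?pr0 //.
  by apply/seteqP; split=> // w /= [[_ Sw] wx]; rewrite wx Sx in Sw.
by rewrite sumr_const -[RHS]mulrA [_%:R / _]mulrC mulrA mulr_natr.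
Qed.

Lemma measurable_Gproc2 m m' (Q : rel {set 'I_n.+1 * 'I_n.+1}) :
  measurable [set w | Q (G m w) (G m' w)].
Proof.
apply: (F_meas (m := maxn m m')).
apply: (filt_fin (f := fun w => (G m w, G m' w)) (fun X => Q X.1 X.2)) => -[X Y].
have -> : [set w | (G m w, G m' w) = (X, Y)] = [set w | G m w = X] `&` [set w | G m' w = Y].
  by apply/seteqP; split=> w /= [-> ->].
by apply: filt_setI; apply: (filt_le _ (filt_Gproc_eq _ _)); rewrite ?leq_maxl ?leq_maxr.
Qed.

Definition next_vertices m w := [set y in codom (v m.+1 w)]%SET.

Lemma card_next_vertices m w : (#|next_vertices m w| <= l)%N.
Proof.
rewrite cardsE; apply: leq_trans (card_size _) _.
by rewrite size_codom card_ord.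
Qed.

Lemma new_edges m w a b : (a, b) \in E m.+1 w -> a \in next_vertices m w /\ b \in next_vertices m w.
Proof. by move=> /E_edges[]// _ av bv; rewrite !inE. Qed.

Lemma small_Gproc m j w K : (small (G m w) K <= small (G (m + j) w) K + j * (l * K))%N.
Proof.
elim: j => [|j IH]; first by rewrite addn0 leq_addr.
apply: leq_trans IH _; rewrite addnS GprocS mulSn addnA leq_add2r.
apply: leq_trans (small_step _ _ (@new_edges (m + j) w)) _; rewrite leq_add2l.
by rewrite leq_mul2r card_next_vertices orbT.
Qed.

(** * Probability that a colouring stays unjoined *)

Lemma N_gt0 : 0 < N.
Proof. by rewrite ltr0n. Qed.

(* If every chosen vertex falls in its own colour class, the forced edge joins two classes. *)
Lemma unjoined_next m w g (psi : {ffun {set 'I_n.+1} -> option 'I_l}) :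
  unjoined g psi (G m.+1 w) -> ~~ [forall i, v m.+1 w i \in colour_class g psi i].
Proof.
move=> sep; apply/negP => /fintype.forallP vi.
have sub : G m w \subset G m.+1 w by apply: Gproc_sub.
have /unjoinedP sep1 := sep.
have /set0Pn[[a b] ab] : E m.+1 w != finset.set0.
  apply: E_neq0 => // i j; apply: contraNN => /= ij.
  by apply/eqP; apply: sep1 (vi i) (vi j) (gconnS sub ij).
have [//|ne /codomP[i ai] /codomP[j bj]] := E_edges _ ab.
case/eqP: ne; rewrite ai bj; congr (v _ _ _).
apply: sep1 (vi i) (vi j) _; rewrite -ai -bj; apply: connect1.
by rewrite /gadj GprocS inE ab orbT.
Qed.

Lemma card_rainbow (C : 'I_l -> {set 'I_n.+1}) q : (forall i, q <= #|C i|)%N ->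
  (q ^ l <= #|[pred x : {ffun 'I_l -> 'I_n.+1} | [forall i, x i \in C i]]|)%N.
Proof.
move=> qC.
have -> : #|[pred x : {ffun 'I_l -> 'I_n.+1} | [forall i, x i \in C i]]| =
          #|family (fun i => mem (C i))|.
  by apply: eq_card => x; rewrite !inE; apply: eq_forallb => i.
rewrite card_family foldrE big_image /= -[X in (q ^ X)%N](card_ord l) -prod_nat_const.
by apply: leq_prod => i _.
Qed.

Lemma ratio_exp_le1 (q k : nat) : (q <= n.+1)%N -> (q%:R / N) ^+ k <= 1.
Proof.
move=> qN; apply: exprn_ile1; first by rewrite divr_ge0.
by rewrite ler_pdivrMr ?N_gt0 // mul1r ler_nat.
Qed.

(** Given the past, with probability at least [(q / n.+1) ^+ l] every chosen vertex falls in its own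
    class, and the colouring is then destroyed. The factors multiply because being unjoined at step
    [m + j] is an event of [F (m + j)]. *)
Lemma pr_unjoined m A g (psi : {ffun {set 'I_n.+1} -> option 'I_l}) q j :
  F m A -> (q <= n.+1)%N -> (forall i, q <= #|colour_class g psi i|)%N ->
  pr P (A `&` [set w | unjoined g psi (G (m + j) w)]) <=
    (1 - (q%:R / N) ^+ l) ^+ j * pr P A.
Proof.
move=> FA qN qC; have mA := F_meas FA.
elim: j => [|j IH].
  rewrite expr0 mul1r; apply: pr_le => //.
  by apply: measurableI => //; apply: measurable_Gproc.
set B := A `&` [set w | unjoined g psi (G (m + j) w)] in IH.
have FB : F (m + j) B.
  by apply: filt_setI; [apply: filt_le FA; rewrite leq_addr | apply: filt_Gproc].
have mB := F_meas FB.
pose S := [pred x : {ffun 'I_l -> 'I_n.+1} | [forall i, x i \in colour_class g psi i]].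
have mS := @measurable_next (m + j) S.
apply: (@le_trans _ _ (pr P (B `&` ~` [set w | S (v (m + j).+1 w)]))).
  apply: pr_le.
  - by apply: measurableI => //; apply: measurable_Gproc.
  - by apply: measurableI => //; apply: measurableC.
  move=> w /= [Aw]; rewrite addnS => sep; split; last exact/negP/unjoined_next.
  by split=> //=; apply: unjoinedS sep; apply: Gproc_sub.
have := pr_split P mB mS; rewrite pr_next // => /eqP.
rewrite addrC -subr_eq => /eqP <-.
apply: (@le_trans _ _ ((1 - (q%:R / N) ^+ l) * pr P B)); last first.
  by rewrite exprS -mulrA ler_wpM2l // subr_ge0 ratio_exp_le1.
rewrite mulrBl mul1r lerB // -mulrA mulrC ler_wpM2l ?pr_ge0 //.
rewrite expr_div_n ler_wpM2r ?invr_ge0 ?exprn_ge0 //.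
by rewrite -natrX ler_nat card_rainbow.
Qed.

Definition stuck (g h : {set 'I_n.+1 * 'I_n.+1}) k q : nat :=
  #|[set x | (k <= #|gcomp g x|)%N && (#|gcomp h x| <= q)%N]%SET|.

(** Too many stuck vertices yield a colouring with [l] classes of at least [q] vertices that is
    still unjoined; a union bound over colourings concludes. *)
Lemma pr_stuck m j k q : (0 < k)%N -> (q <= n.+1)%N ->
  pr P [set w | 2 * q * l <= stuck (G m w) (G (m + j) w) k q]%N <=
    (l.+1 ^ (n.+1 %/ k))%:R * (1 - (q%:R / N) ^+ l) ^+ j.
Proof.
move=> k0 qN; set B := [set w | _].
have mB : measurable B.
  exact: (measurable_Gproc2 m (m + j) (fun g h => 2 * q * l <= stuck g h k q)%N).
have mG g : measurable [set w | G m w = g] by apply: F_meas; apply: filt_Gproc_eq.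
rewrite (pr_fibers P mB mG).
set c := (1 - _) ^+ j.
have c0 : 0 <= c by rewrite exprn_ge0 // subr_ge0 ratio_exp_le1.
(* Fixing the graph [g] at step [m] makes the family of candidate colourings deterministic, so the
   bound is proved fibre by fibre. *)
have -> : (l.+1 ^ (n.+1 %/ k))%:R * c =
    \sum_g (l.+1 ^ (n.+1 %/ k))%:R * c * pr P (setT `&` [set w | G m w = g]).
  by rewrite -mulr_sumr -(pr_fibers P measurableT mG) prT mulr1.
apply: ler_sum => g _; rewrite setTI.
pose good := [pred psi : {ffun {set 'I_n.+1} -> option 'I_l} |
  (psi \in pffun_on None (mem (big_comps g k)) predT) &&
  [forall i, q <= #|colour_class g psi i|]%N].
apply: (@le_trans _ _ (\sum_(psi <- enum good)
    pr P ([set w | G m w = g] `&` [set w | unjoined g psi (G (m + j) w)]))).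
  apply: pr_union_bound.
  - exact: measurableI.
  - by move=> psi; apply: measurableI => //; apply: measurable_Gproc.
  move=> w []; rewrite /B /= => + gw; rewrite gw => Bw.
  have gs : g \subset G (m + j) w by rewrite -gw; apply: Gproc_sub; rewrite leq_addr.
  have [psi psiS /andP[sep big]] := separating_colouring gs Bw.
  by exists psi => //; rewrite mem_enum /= inE psiS.
rewrite big_enum /=.
apply: (@le_trans _ _ (\sum_(psi in good) c * pr P [set w | G m w = g])).
  rewrite big_mkcond [leRHS]big_mkcond /=; apply: ler_sum => psi _; case: ifP => //.
  rewrite inE => /andP[_ /fintype.forallP qC].
  by apply: pr_unjoined => //; apply: filt_Gproc_eq.
rewrite sumr_const -[leLHS]mulr_natl -[leRHS]mulrA ler_wpM2r ?mulr_ge0 ?pr_ge0 //.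
rewrite ler_nat; apply: (@leq_trans #|pffun_on (None : option 'I_l) (mem (big_comps g k)) predT|).
  by apply: fintype.subset_leq_card; apply/fintype.subsetP => psi /andP[].
(* Each of the at most [n.+1 %/ k] big components takes one of [l] colours or [None]. *)
rewrite card_pffun_on cardT -cardE card_option card_ord leq_pexp2l //.
by rewrite leq_divRL // mulnC card_big_comps.
Qed.

(** * Survival of a single component *)

Lemma gcomp_next m w x : (forall i, v m.+1 w i \notin gcomp (G m w) x) ->
  gcomp (G m.+1 w) x = gcomp (G m w) x.
Proof.
move=> vS; rewrite GprocS; apply: gcomp_untouched (@new_edges m w) _ => y.
by rewrite inE => /codomP[i ->]; have := vS i; rewrite mem_gcomp.
Qed.

Lemma bernoulli_le (u : R) k : 0 <= u <= 1 -> 1 - k%:R * u <= (1 - u) ^+ k.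
Proof.
move=> /andP[u0 u1]; elim: k => [|k IH]; first by rewrite mul0r subr0 expr0.
rewrite exprS; apply: (@le_trans _ _ ((1 - u) * (1 - k%:R * u))); last first.
  by rewrite ler_wpM2l // subr_ge0.
rewrite -natr1; have : 0 <= k%:R * (u * u) by rewrite mulr_ge0 // mulr_ge0.
lra.
Qed.

(** A component [S] is unchanged if all [l] new vertices avoid it, which has probability at least
    [(1 - #|S| / n.+1) ^+ l]; Bernoulli's inequality bounds this below. *)
Lemma pr_gcomp_step m x (p : pred nat) k : (forall c, p c -> c <= k)%N ->
  (1 - (l * k)%:R / N) * pr P [set w | p #|gcomp (G m w) x|] <=
    pr P [set w | p #|gcomp (G m.+1 w) x|].
Proof.
move=> pk.
have mp j : measurable [set w | p #|gcomp (G j w) x|].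
  exact: (measurable_Gproc j (fun g => p #|gcomp g x|)).
have Ff S : F m [set w | gcomp (G m w) x = S].
  have -> : [set w | gcomp (G m w) x = S] = [set w | gcomp (G m w) x == S].
    by apply/seteqP; split=> w /eqP.
  exact: (@filt_Gproc m m (fun g => gcomp g x == S)).
have mf S := F_meas (Ff S).
rewrite (pr_fibers P (mp m) mf) (pr_fibers P (mp m.+1) mf) mulr_sumr.
apply: ler_sum => S _; have [pS|npS] := boolP (p #|S|); last first.
  rewrite (_ : [set w | p #|gcomp (G m w) x|] `&` _ = set0) ?pr0 ?mulr0 ?pr_ge0 //.
  by apply/seteqP; split=> // w /= [+ eS]; rewrite eS (negbTE npS).
pose avoid := [pred y : {ffun 'I_l -> 'I_n.+1} | [forall i, y i \in (~: S)%SET]].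
apply: (@le_trans _ _ (pr P ([set w | gcomp (G m w) x = S] `&` [set w | avoid (v m.+1 w)]))).
  rewrite pr_next // (_ : [set w | p #|gcomp (G m w) x|] `&` _ = [set w | gcomp (G m w) x = S]); last first.
    by apply/seteqP; split=> [w []//|w /= eS]; split=> //=; rewrite eS.
  rewrite mulrC -mulrA ler_wpM2l ?pr_ge0 //.
  have SN : (#|S| <= n.+1)%N by rewrite -[X in (_ <= X)%N](card_ord n.+1) max_card.
  apply: (@le_trans _ _ ((1 - #|S|%:R / N) ^+ l)); last first.
    have -> : 1 - #|S|%:R / N = (n.+1 - #|S|)%:R / N.
      by rewrite natrB // mulrBl divff // lt0r_neq0 ?N_gt0.
    rewrite expr_div_n ler_wpM2r ?invr_ge0 ?exprn_ge0 // -natrX ler_nat.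
    by apply: card_rainbow => i; rewrite leq_subLR cardsC card_ord.
  apply: le_trans (bernoulli_le l _); last first.
    by rewrite divr_ge0 //= ler_pdivrMr ?N_gt0 // mul1r ler_nat.
  rewrite lerD2l lerN2 natrM -mulrA ler_wpM2l // ler_wpM2r ?invr_ge0 //.
  by rewrite ler_nat pk.
apply: pr_le.
- by apply: measurableI => //; apply: measurable_next.
- exact: measurableI.
move=> w /= [eS /fintype.forallP av]; split=> //.
rewrite gcomp_next eS // => i; by have := av i; rewrite inE.
Qed.

(** The condition [l * k <= n.+1] keeps the one-step factor nonnegative, so that the bound can be
    iterated. *)
Lemma pr_gcomp_survive m j x (p : pred nat) k : (forall c, p c -> c <= k)%N ->
  (l * k <= n.+1)%N ->
  (1 - (l * k)%:R / N) ^+ j * pr P [set w | p #|gcomp (G m w) x|] <=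
    pr P [set w | p #|gcomp (G (m + j) w) x|].
Proof.
move=> pk lkN; elim: j => [|j IH]; first by rewrite expr0 mul1r addn0.
rewrite addnS; apply: le_trans (pr_gcomp_step (m + j) x pk).
rewrite exprS -mulrA ler_wpM2l // subr_ge0 ler_pdivrMr ?N_gt0 // mul1r.
by rewrite ler_nat.
Qed.

(** * Merging of two components of linear size *)

Hypothesis merging : forall (eps : R), 0 < eps -> forall m, (1 <= m)%N ->
  forall C C' : {set 'I_n.+1}, C != C' ->
    eps * N <= #|C|%:R -> eps * N <= #|C'|%:R ->
  forall A, F m.-1 A ->
    A `<=` [set w | is_component (G m.-1 w) C /\ is_component (G m.-1 w) C'] ->
    ((eps ^+ l)%:E * P A <= P (A `&` [set w | same_comp (G m w) C C']))%E.

Definition both_large (a : R) (g : {set 'I_n.+1 * 'I_n.+1}) x y :=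
  (a * N <= #|gcomp g x|%:R) && (a * N <= #|gcomp g y|%:R).

Lemma both_largeS a (g h : {set 'I_n.+1 * 'I_n.+1}) x y : g \subset h -> both_large a g x y -> both_large a h x y.
Proof.
move=> gh /andP[gx gy]; apply/andP; split.
  by apply: le_trans gx _; rewrite ler_nat fintype.subset_leq_card ?gcompS.
by apply: le_trans gy _; rewrite ler_nat fintype.subset_leq_card ?gcompS.
Qed.

(** The merging property concerns fixed sets [C] and [C'], so [A] is cut according to the pair of
    components of [x] and [y]. *)
Lemma pr_unmerged_step m A a x y : 0 < a -> F m A ->
  A `<=` [set w | both_large a (G m w) x y && ~~ gconn (G m w) x y] ->
  pr P (A `&` [set w | ~~ gconn (G m.+1 w) x y]) <= (1 - a ^+ l) * pr P A.
Proof.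
move=> a0 FA Asub; have mA := F_meas FA.
pose f w := (gcomp (G m w) x, gcomp (G m w) y).
have Ff S : F m [set w | f w = S].
  have -> : [set w | f w = S] = [set w | (gcomp (G m w) x, gcomp (G m w) y) == S].
    by apply/seteqP; split=> w /eqP.
  exact: (@filt_Gproc m m (fun g => (gcomp g x, gcomp g y) == S)).
have mf S := F_meas (Ff S).
have mn : measurable [set w | ~~ gconn (G m.+1 w) x y].
  exact: (measurable_Gproc m.+1 (fun g => ~~ gconn g x y)).
have mAn := measurableI _ _ mA mn.
rewrite (pr_fibers P mA mf) (pr_fibers P mAn mf) mulr_sumr.
apply: ler_sum => -[C C'] _.
set B := A `&` [set w | f w = (C, C')].
have FB : F m B by exact: filt_setI.
have mB := F_meas FB.
have -> : A `&` [set w | ~~ gconn (G m.+1 w) x y] `&` [set w | f w = (C, C')] =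
          B `&` ~` [set w | gconn (G m.+1 w) x y].
  by apply/seteqP; split=> w /=; [case=> -[? /negP ?] ?|case=> -[? ?] /negP ?].
have mc : measurable [set w | gconn (G m.+1 w) x y].
  exact: (measurable_Gproc m.+1 (fun g => gconn g x y)).
have [->|/set0P[w0 [Aw0 fw0]]] := eqVneq B set0; first by rewrite set0I pr0 mulr0.
have /= /andP[/andP[lx ly] nc] := Asub _ Aw0.
case: fw0 => eC eC'.
have CC : C != C'.
  by apply: contraNneq nc => e; rewrite -mem_gcomp eC e -eC' gcomp_refl.
rewrite eC in lx; rewrite eC' in ly.
have Bsub : B `<=` [set w | is_component (G m w) C /\ is_component (G m w) C'].
  by move=> w [_ [<- <-]]; split; [exists x | exists y].
have := @merging a a0 m.+1 isT C C' CC lx ly B FB Bsub.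
have ms : measurable [set w | same_comp (G m.+1 w) C C'].
  exact: (measurable_Gproc m.+1 (fun g => same_comp g C C')).
rewrite !prE //; last exact: measurableI.
rewrite -EFinM lee_fin => mrg.
have : pr P (B `&` [set w | same_comp (G m.+1 w) C C']) <=
       pr P (B `&` [set w | gconn (G m.+1 w) x y]).
  apply: pr_le; [exact: measurableI|exact: measurableI|].
  move=> w [Bw] /= sc; split=> //=; case: Bw => _ [eCw eCw'].
  have sub : G m w \subset G m.+1 w by apply: Gproc_sub.
  case/fintype.existsP: sc => [x' /andP[xC /fintype.existsP[y' /andP[yC xy]]]].
  rewrite -eCw mem_gcomp in xC; rewrite -eCw' mem_gcomp gconn_sym in yC.
  apply: gconn_trans (gconnS sub xC) _; apply: gconn_trans xy _.
  exact: gconnS sub yC.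
have := pr_split P mB mc; lra.
Qed.

(** Components only grow, so both stay large while unmerged, and each step merges them with
    conditional probability at least [a ^+ l]. *)
Lemma pr_unmerged m j a x y : 0 < a <= 1 ->
  pr P [set w | both_large a (G m w) x y && ~~ gconn (G (m + j) w) x y] <= (1 - a ^+ l) ^+ j.
Proof.
move=> /andP[a0 a1].
have mE i : measurable [set w | both_large a (G m w) x y && ~~ gconn (G (m + i) w) x y].
  exact: (measurable_Gproc2 m (m + i) (fun g h => both_large a g x y && ~~ gconn h x y)).
elim: j => [|j IH]; first by rewrite expr0; apply: pr_le1.
set A := [set w | _] in IH.
have FA : F (m + j) A.
  have -> : A = [set w | both_large a (G m w) x y] `&` [set w | ~~ gconn (G (m + j) w) x y].
    by apply/seteqP; split=> w /=; rewrite /A /= => /andP.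
  apply: filt_setI; last exact: (@filt_Gproc _ _ (fun g => ~~ gconn g x y)).
  by apply: (@filt_Gproc _ _ (fun g => both_large a g x y)); rewrite leq_addr.
apply: (@le_trans _ _ ((1 - a ^+ l) * pr P A)); last first.
  by rewrite exprS ler_wpM2l // subr_ge0 exprn_ile1 // ltW.
apply: le_trans (@pr_unmerged_step (m + j) A a x y a0 FA _).
  apply: pr_le => //.
    apply: measurableI => //; first exact: F_meas FA.
    exact: (measurable_Gproc (m + j).+1 (fun g => ~~ gconn g x y)).
  move=> w /= /andP[la]; rewrite addnS => nc; split=> //; rewrite /A /= la /=.
  by apply: contraNN nc; apply: gconnS; apply: Gproc_sub.
move=> w; rewrite /A /= => /andP[la ->]; rewrite andbT.
by apply: both_largeS la; apply: Gproc_sub; rewrite leq_addr.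
Qed.

End VertexRuleProcess.

(** * Limiting component densities *)

Lemma floorn_le (R : realType) (s t : R) N : s <= t -> (floorn s N <= floorn t N)%N.
Proof. by move=> st; apply: le_truncn; rewrite ler_wpM2r. Qed.

Lemma floorn_gap (R : realType) (s t : R) N : 0 <= s <= t ->
  exists2 j, (floorn s N + j)%N = floorn t N &
    (t - s) * N%:R - 1 <= j%:R <= (t - s) * N%:R + 1.
Proof.
move=> /andP[s0 st]; exists (floorn t N - floorn s N)%N.
  by rewrite subnKC // floorn_le.
rewrite natrB ?floorn_le //.
have /truncn_itv : 0 <= s * N%:R by rewrite mulr_ge0.
have /truncn_itv : 0 <= t * N%:R by rewrite mulr_ge0 // (le_trans s0).
by rewrite -/(floorn t N) -/(floorn s N) -!natr1; lra.
Qed.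

Lemma small_le_stuck n (g h : {set 'I_n.+1 * 'I_n.+1}) k q :
  (small h q.+1 <= small g k + stuck g h k q)%N.
Proof.
rewrite /small /stuck; set A := [set x | _]%SET; set B := [set x | _]%SET.
set C := [set x | _]%SET.
apply: (@leq_trans #|(B :|: C)%SET|); last exact: leq_card_setU.
apply: fintype.subset_leq_card; apply/fintype.subsetP => x; rewrite !inE ltnS.
by case: ltnP => //= _ ->.
Qed.

Lemma card_between n (g : {set 'I_n * 'I_n}) k k' : (k' <= k)%N ->
  (#|[pred x | k' <= #|gcomp g x| < k]| + small g k')%N = small g k.
Proof.
move=> kk; rewrite /small -[RHS](cardsID [set x | #|gcomp g x| < k']%N%SET) addnC.
congr (_ + _)%N; apply: eq_card => x; rewrite !inE; last by rewrite -leqNgt.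
by case: ltnP => [/leq_trans -> //|]; rewrite andbF.
Qed.

Lemma exprB1_le_expR (R : realType) (c : R) j : c <= 1 -> (1 - c) ^+ j <= expR (- (c * j%:R)).
Proof.
move=> c1; rewrite -mulNr expRM_natr lerXn2r ?nnegrE ?expR_ge0 ?subr_ge0 //.
exact: expR_ge1Dx.
Qed.

(** Combines [1 + 2 * c <= expR (2 * c)] with [1 <= (1 - c) * (1 + 2 * c)], where [c <= 1 / 2]
    enters. *)
Lemma expR_le_exprB1 (R : realType) (c : R) j : 0 <= c -> c <= 1 / 2 ->
  expR (- (2 * c * j%:R)) <= (1 - c) ^+ j.
Proof.
move=> c0 c1; have c2 : 0 <= 1 - c by lra.
rewrite -mulNr expRM_natr lerXn2r ?nnegrE ?expR_ge0 // expRN.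
rewrite -(ler_pM2r (expR_gt0 (2 * c))) mulVf ?gt_eqF ?expR_gt0 //.
apply: le_trans (_ : (1 - c) * (1 + 2 * c) <= _); first by nra.
by rewrite ler_wpM2l // expR_ge1Dx.
Qed.

Lemma expRN_le_inv (R : realType) (x : R) : 0 < x -> expR (- x) <= x^-1.
Proof.
move=> x0; rewrite expRN lef_pV2 ?posrE ?expR_gt0 //.
by apply: le_trans (expR_ge1Dx _); rewrite lerDr.
Qed.

Section ComponentDensities.
Unset Implicit Arguments.
Variables (R : realType) (l : nat) (d : measure_display).
Variables (T : nat -> measurableType d) (P : forall n, probability (T n) R).
Variables (F : forall n, nat -> set (set (T n))).
Variables (v : forall n, nat -> T n -> {ffun 'I_l -> 'I_n.+1}).
Variables (E : forall n, nat -> T n -> {set 'I_n.+1 * 'I_n.+1}).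
Variable rho_ : nat -> R -> R.
Hypothesis rule : is_vertex_rule P F v E.
Hypothesis merge : is_merging l P F E.
Hypothesis loc : locally_convergent P E rho_.
Set Implicit Arguments.

Local Notation G n t w := (Gproc (E n) (floorn t n.+1) w).
Local Notation N n := (n.+1%:R : R).

Let F_sigma n m : sigma_algebra setT (F n m).
Proof. by case: rule. Qed.
Let F_meas n m : F n m `<=` measurable.
Proof. by case: rule => _ []. Qed.
Let F_filt n m : F n m `<=` F n m.+1.
Proof. by case: rule => _ [_ []]. Qed.
Let F_v n m x : (1 <= m)%N -> F n m [set w | v n m w = x].
Proof. by case: rule => _ [_ [_ [+ _]]]; apply. Qed.
Let v_unif n m A x : (1 <= m)%N -> F n m.-1 A ->
  P n (A `&` [set w | v n m w = x]) = (P n A * ((n.+1 ^ l)%:R^-1)%:E)%E.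
Proof. by case: rule => _ [_ [_ [_ [+ _]]]]; apply. Qed.
Let F_E n m X : (1 <= m)%N -> F n m [set w | E n m w = X].
Proof. by case: rule => _ [_ [_ [_ [_ [+ _]]]]]; apply. Qed.
Let E_edges n m w a b : (1 <= m)%N -> (a, b) \in E n m w ->
  [/\ a != b, a \in codom (v n m w) & b \in codom (v n m w)].
Proof. by case: rule => _ [_ [_ [_ [_ [_ [+ _]]]]]]; apply. Qed.
Let E_neq0 n m w : (1 <= m)%N ->
  (forall i j : 'I_l, i != j -> ~~ gconn (Gproc (E n) m.-1 w) (v n m w i) (v n m w j)) ->
  E n m w != finset.set0.
Proof. by case: rule => _ [_ [_ [_ [_ [_ [_]]]]]]; apply. Qed.

Let mG n m (Q : pred {set 'I_n.+1 * 'I_n.+1}) : measurable [set w | Q (Gproc (E n) m w)].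
Proof. exact: measurable_Gproc (F_sigma n) (F_meas (n := n)) (F_filt (n := n)) (@F_E n) m Q. Qed.

(** * Limiting proportions of vertices in components of bounded size *)

Definition density K t : R := \sum_(1 <= k < K) rho_ k t.

Lemma whp_density K t e : 0 <= t -> 0 < e ->
  whp P (fun n w => `|(small (G n t w) K)%:R / N n - density K t| <= e).
Proof.
(* The sum is empty for [K] equal to [0] or [1]; each later step adds a term of index at least [1],
   as local convergence requires. *)
move=> t0; rewrite /density; elim: K e => [|[|K] IH] e e0.
- by apply: whp_sure => n w; rewrite -sum_Nk !big_geq // mul0r subr0 normr0 ltW.
- by apply: whp_sure => n w; rewrite -sum_Nk !big_geq // mul0r subr0 normr0 ltW.
have e2 : 0 < e / 2 by rewrite divr_gt0.
have [_ /(_ K.+1 t isT t0) cK] := loc.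
have /whp_and/(_ (IH _ e2)) := cvg_in_prob_whp (fun n => @mG n (floorn t n.+1)
   (fun g => e / 2 < `|(Nk g K.+1)%:R / N n - rho_ K.+1 t|)) e2 cK.
apply: whp_impl => n w [h1 h2].
rewrite big_nat_recr //= -sum_Nk big_nat_recr //= sum_Nk natrD mulrDl opprD addrACA.
by rewrite (le_trans (ler_normD _ _)) // [leRHS](splitr e) lerD.
Qed.

Lemma density_ge0 K t : 0 <= t -> 0 <= density K t.
Proof. by move=> t0; apply: sumr_ge0 => k _; case: loc => /(_ k t t0)/andP[]. Qed.

Lemma density_homo t : 0 <= t -> {homo density^~ t : K K' / (K <= K')%N >-> K <= K'}.
Proof.
move=> t0 K K' KK; have [K1|K1] := leqP 1 K; last first.
  have -> : density K t = 0 by rewrite /density big_geq // ltnW.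
  exact: density_ge0.
rewrite /density [leRHS](big_cat_nat (n := K)) //= lerDl.
by apply: sumr_ge0 => k _; case: loc => /(_ k t t0)/andP[].
Qed.

Lemma density_le1 K t : 0 <= t -> density K t <= 1.
Proof.
move=> t0; apply/ler_addgt0Pr => e e0.
apply: (@whp_const _ _ _ P); apply: whp_impl (whp_density K t0 e0) => n w.
have : (small (G n t w) K)%:R / N n <= 1.
  by rewrite ler_pdivrMr ?ltr0n // mul1r ler_nat small_le.
by rewrite ler_distlC; move: (_ / _) => z h /andP[h1 h2]; lra.
Qed.

Lemma density_anti K s t : 0 <= s <= t -> density K t <= density K s.
Proof.
move=> st; have /andP[s0 st'] := st; have t0 := le_trans s0 st'.
apply/ler_addgt0Pr => e e0; have e2 : 0 < e / 2 by rewrite divr_gt0.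
apply: (@whp_const _ _ _ P).
apply: whp_impl (whp_and (whp_density K s0 e2) (whp_density K t0 e2)) => n w [].
have : (small (G n t w) K)%:R / N n <= (small (G n s w) K)%:R / N n.
  by rewrite ler_wpM2r ?invr_ge0 // ler_nat smallS // Gproc_sub // floorn_le.
by rewrite !ler_distlC; move: (_ / _) (_ / _) => y z h /andP[h1 h2] /andP[h3 h4]; lra.
Qed.

(** Each of the at most [(t - s) * n.+1 + 1] steps costs at most [l * K] small vertices; the extra
    step due to rounding vanishes after division by [n.+1]. *)
Lemma density_lipschitz K s t : 0 <= s <= t ->
  density K s - density K t <= (l * K)%:R * (t - s).
Proof.
move=> st; have /andP[s0 st'] := st; have t0 := le_trans s0 st'.
apply/ler_addgt0Pr => e e0; have e3 : 0 < e / 3 by rewrite divr_gt0.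
apply: (@whp_const _ _ _ P).
apply: whp_impl (whp_and (whp_near P (near_div_le (l * K)%:R e3))
  (whp_and (whp_density K s0 e3) (whp_density K t0 e3))) => n w [lK []].
have [j js /andP[_ j1]] := floorn_gap n.+1 st.
have N0 : 0 < N n by rewrite ltr0n.
have : (small (G n s w) K)%:R / N n <= (small (G n t w) K)%:R / N n +
    (l * K)%:R * (t - s) + (l * K)%:R / N n.
  have := small_Gproc (@E_edges n) (floorn s n.+1) j w K; rewrite js.
  rewrite -(ler_nat R) natrD natrM => sj.
  rewrite ler_pdivrMr // !mulrDl !divfK ?gt_eqF //.
  apply: le_trans sj _; rewrite -addrA lerD2l.
  apply: le_trans (_ : ((t - s) * N n + 1) * (l * K)%:R <= _).
    by rewrite ler_wpM2r.
  by rewrite le_eqVlt; apply/orP; left; apply/eqP; ring.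
rewrite !ler_distlC; move: lK; move: ((l * K)%:R / N n) (_ / N n) (_ / N n) => z x y.
by move=> lK h /andP[h1 h2] /andP[h3 h4]; lra.
Qed.

(** * Grouping into components of linear size *)

Lemma whp_grouping e : 0 < e <= 1 -> exists2 C : R, 0 < C &
  forall k t gam, (0 < k)%N -> 0 <= t -> C / k%:R <= gam ->
  whp P (fun n w => (stuck (G n t w) (G n (t + gam) w) k
                       (floorn (e / (2 * l.+1)%:R) n.+1))%:R <= e * N n).
Proof.
move=> /andP[e0 e1]; set b := e / _.
have L0 : 0 < (2 * l.+1)%:R :> R by rewrite ltr0n.
have b0 : 0 < b by rewrite divr_gt0.
have b1 : b <= 1.
  by rewrite ler_pdivrMr // mul1r (le_trans e1) // ler1n.
(* A lower bound for [(q / n.+1) ^+ l] with [q = floorn b n.+1], valid once rounding costs at most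
   half of [b * n.+1]. *)
pose c := (b / 2) ^+ l.
have c0 : 0 < c by rewrite exprn_gt0 // divr_gt0.
(* This constant depends on [e] and [l] only. For [gam >= C / k] the decay exponent is at least
   [2 * l.+1 * n.+1 / k - c], which beats the [l * n.+1 / k] coming from the number of
   colourings. *)
exists ((2 * l.+1)%:R / c); first by rewrite divr_gt0.
move=> k t gam k0 t0 gamC; have kR0 : 0 < k%:R :> R by rewrite ltr0n.
have gam0 : 0 <= gam by apply: le_trans gamC; rewrite !divr_ge0 // ltW.
have tg : 0 <= t <= t + gam by rewrite t0 lerDl.
pose B n := [set w | 2 * floorn b n.+1 * l <=
  stuck (G n t w) (G n (t + gam) w) k (floorn b n.+1)]%N.
have mB n : measurable (B n).
  exact: (measurable_Gproc2 (F_sigma n) (F_meas (n := n)) (F_filt (n := n)) (@F_E n) _ _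
    (fun g h => 2 * floorn b n.+1 * l <= stuck g h k (floorn b n.+1))%N).
have qN n : b * N n - 1 < (floorn b n.+1)%:R <= b * N n.
  have /truncn_itv/andP[h1 h2] : 0 <= b * N n by rewrite mulr_ge0 // ltW.
  by rewrite /floorn h1 andbT ltrBlDr natr1.
have prB : \forall n \near \oo, pr (P n) (B n) <= expR c * k%:R / N n.
  have b2 : 0 < b / 2 by rewrite divr_gt0.
  apply: filterS (near_div_le 1 b2) => n Nb.
  have N0 : 0 < N n by rewrite ltr0n.
  have [j js /andP[jl _]] := floorn_gap n.+1 tg.
  have qN1 : (floorn b n.+1 <= n.+1)%N.
    rewrite -(ler_nat R); have /andP[_ /le_trans] := qN n; apply.
    by rewrite ler_piMl // ltW.
  have := pr_stuck (F_sigma n) (F_meas (n := n)) (F_filt (n := n)) (@F_v n) (@v_unif n)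
    (@F_E n) (@E_edges n) (@E_neq0 n) (floorn t n.+1) j k0 qN1.
  rewrite js => /le_trans; apply.
  set u := _ ^+ l.
  have cu : c <= u.
    rewrite lerXn2r ?nnegrE ?divr_ge0 //; first exact: ltW.
    rewrite ler_pdivlMr //; move: Nb; rewrite ler_pdivrMr // => Nb.
    by have /andP[/ltW qb _] := qN n; lra.
  have u1 : u <= 1 by apply: ratio_exp_le1.
  have h1 : (1 - u) ^+ j <= expR (c - (2 * l.+1)%:R / k%:R * N n).
    apply: le_trans (exprB1_le_expR j u1) _; rewrite ler_expR.
    have h : c * ((t + gam - t) * N n - 1) <= u * j%:R.
      apply: le_trans (_ : c * j%:R <= _); first by rewrite ler_pM2l.
      by rewrite ler_wpM2r.
    have h' : (2 * l.+1)%:R / k%:R * N n <= c * (gam * N n).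
      rewrite mulrA ler_wpM2r // -ler_pdivrMl //.
      by apply: le_trans gamC; rewrite mulrC mulrAC.
    move: h'; move: ((2 * l.+1)%:R / k%:R * N n) => z h'.
    by move: h; rewrite addrAC subrr add0r mulrBr mulr1; lra.
  have h2 : (l.+1 ^ (n.+1 %/ k))%:R <= expR (l%:R * N n / k%:R) :> R.
    apply: (@le_trans _ _ (expR l%:R ^+ (n.+1 %/ k))).
      rewrite natrX lerXn2r ?nnegrE ?expR_ge0 //.
      by rewrite -nat1r expR_ge1Dx.
    rewrite -expRM_natr ler_expR -mulrA ler_wpM2l // ler_pdivlMr //.
    by rewrite -natrM ler_nat leq_trunc_div.
  apply: (@le_trans _ _ (expR (l%:R * N n / k%:R) * expR (c - (2 * l.+1)%:R / k%:R * N n))).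
    by apply: ler_pM => //; rewrite exprn_ge0 // subr_ge0.
  rewrite -expRD; apply: (@le_trans _ _ (expR (c - N n / k%:R))).
    rewrite ler_expR; have : 0 <= N n / k%:R by rewrite divr_ge0 // ltW.
    have -> : (2 * l.+1)%:R = 2 * l%:R + 2 :> R by rewrite natrM -natr1; ring.
    have -> : (2 * l%:R + 2) / k%:R * N n = (2 * l%:R + 2) * (N n / k%:R) :> R by ring.
    rewrite -mulrA; move: (N n / k%:R) => z z0.
    have : 0 <= l%:R * z by rewrite mulr_ge0.
    lra.
  (* The bound [expR (- x) <= x^-1] turns exponential decay into the rate [M / n.+1]. *)
  rewrite expRD -mulrA ler_wpM2l ?expR_ge0 //.
  by apply: le_trans (expRN_le_inv _) _; rewrite ?divr_gt0 // invf_div.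
apply: whp_impl (whp_not mB prB) => n w /negP; rewrite -ltnNge => /ltnW.
rewrite -(ler_nat R) => /le_trans; apply; rewrite !natrM.
have /andP[_ qb] := qN n; apply: (@le_trans _ _ (2 * (b * N n) * l%:R)).
  by rewrite ler_wpM2r // ler_wpM2l.
have -> : 2 * (b * N n) * l%:R = e * N n * (2 * l%:R / (2 * l.+1)%:R) by rewrite /b; ring.
rewrite ler_piMr ?mulr_ge0 ?(ltW e0) // ler_pdivrMr // mul1r natrM.
by rewrite ler_wpM2l // ler_nat.
Qed.

(** A linear threshold eventually exceeds any fixed [K]. Hence a vertex in a component of fewer than
    [K] vertices at the later time either was below [k] at time [t] or is stuck. *)
Lemma density_grouping e : 0 < e <= 1 -> exists2 C : R, 0 < C &
  forall k K t, (0 < k)%N -> 0 <= t -> density K (t + C / k%:R) <= density k t + e.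
Proof.
move=> /andP[e0 e1]; have e2 : 0 < e / 2 <= 1 by apply/andP; split; lra.
have e4 : 0 < e / 4 by rewrite divr_gt0.
have [C C0 HC] := whp_grouping e2; exists C => // k K t k0 t0.
have tC : 0 <= t + C / k%:R by rewrite addr_ge0 // divr_ge0 // ltW.
apply: (@whp_const _ _ _ P); move: HC; set b := _ / (2 * l.+1)%:R => HC.
have b0 : 0 < b by rewrite !divr_gt0 // ltr0n.
apply: whp_impl (whp_and (whp_near P (near_div_le K%:R b0)) (whp_and (HC k t _ k0 t0 (lexx _))
  (whp_and (whp_density k t0 e4) (whp_density K tC e4)))) => n w [nK [hs []]].
have N0 : 0 < N n by rewrite ltr0n.
have Kq : (K <= (floorn b n.+1).+1)%N.
  rewrite -(ler_nat R); apply: le_trans (ltW (truncnS_gt _)).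
  by rewrite -ler_pdivrMr.
have : (small (G n (t + C / k%:R) w) K)%:R / N n <= (small (G n t w) k)%:R / N n + e / 2.
  rewrite ler_pdivrMr // mulrDl divfK ?gt_eqF //.
  apply: le_trans (_ : (small (G n t w) k)%:R + (stuck (G n t w)
    (G n (t + C / k%:R) w) k (floorn b n.+1))%:R <= _); last by rewrite lerD2l.
  rewrite -natrD ler_nat; apply: leq_trans (small_le_stuck _ _ _ _).
  exact: small_leK.
rewrite !ler_distlC; move: (_ / N n) (_ / N n) => x y h /andP[h1 h2] /andP[h3 h4]; lra.
Qed.

(** The survival bound is applied to every vertex and summed, which compares the expected numbers of
    vertices with component size in [[k', k)] at the two times. *)
Lemma density_survival k k' s t : (k' <= k)%N -> 0 <= s <= t ->
  expR (- ((2 * l * k)%:R * (t - s) + 1)) * (density k s - density k' s) <=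
    density k t - density k' t.
Proof.
move=> kk st; have /andP[s0 st'] := st; have t0 := le_trans s0 st'.
set th := expR _; have th0 : 0 <= th by exact: expR_ge0.
have th1 : th <= 1.
  by rewrite -expR0 ler_expR oppr_le0 addr_ge0 // mulr_ge0 // subr_ge0.
apply/ler_addgt0Pr => e e0; have e6 : 0 < e / 6 by rewrite divr_gt0.
(* From [2 * l * k <= n.+1], the one-step loss is at most one half, and the rounding of the number
   of steps costs at most the [+ 1] in the exponent. *)
have near1 := near_div_le (2 * l * k)%:R (@ltr01 R).
have near2 := whp_and (whp_and (whp_density k s0 e6) (whp_density k' s0 e6))
  (whp_and (whp_density k t0 e6) (whp_density k' t0 e6)) e6.
have [n [nlk [A [mA AQ pA]]]] := filter_ex (filterI near1 near2).
have N0 : 0 < N n by rewrite ltr0n.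
have Nn0 : N n != 0 by rewrite gt_eqF.
have [j js /andP[_ ju]] := floorn_gap n.+1 st.
pose D u := density k u - density k' u.
pose p := [pred c : nat | k' <= c < k]%N.
pose Q (x : 'I_n.+1) (g : {set 'I_n.+1 * 'I_n.+1}) := p #|gcomp g x|.
have cnt g : #|[pred x | Q x g]|%:R = (small g k)%:R - (small g k')%:R :> R.
  by rewrite -(card_between g kk) natrD addrK.
(* Two of the three errors come from the densities at [k] and [k'], the third from the complement of
   [A]. *)
have lower : (D s - 3 * (e / 6)) * N n <= \sum_x pr (P n) [set w | Q x (G n s w)].
  apply: le_trans (@sum_pr_ge _ _ _ (P n) _ _ _ Q (mG (n := n) (floorn s n.+1)) A
    ((D s - 2 * (e / 6)) * N n) mA _).
    rewrite mulrAC ler_pM2r //.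
    have D0 : 0 <= D s by rewrite subr_ge0 density_homo.
    have D1 : D s <= 1 by have := density_le1 k s0; have := density_ge0 k' s0; rewrite /D; lra.
    by have := pr_le1 (P n) mA; move: pA; move: (pr _ _) (D s) D0 D1 => z y; nra.
  move=> w /AQ[[h1 h2] _]; rewrite cnt -ler_pdivlMr // mulrBl.
  move: h1 h2; rewrite !ler_distlC; move: (_ / N n) (_ / N n) => x y.
  by rewrite /D => /andP[h1 h2] /andP[h3 h4]; lra.
have upper : \sum_x pr (P n) [set w | Q x (G n t w)] <= (D t + 3 * (e / 6)) * N n.
  have D0 : 0 <= D t by rewrite subr_ge0 density_homo.
  apply: le_trans (@sum_pr_le _ _ _ (P n) _ _ _ Q (mG (n := n) (floorn t n.+1)) A
    ((D t + 2 * (e / 6)) * N n) mA _ _) _.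
  - by rewrite mulr_ge0 // addr_ge0 // mulr_ge0 // ltW.
  - move=> w /AQ[_ [h1 h2]]; rewrite cnt -ler_pdivrMr // mulrBl.
    move: h1 h2; rewrite !ler_distlC; move: (_ / N n) (_ / N n) => x y.
    by rewrite /D => /andP[h1 h2] /andP[h3 h4]; lra.
  by rewrite card_ord [N n * _]mulrC -mulrDl ler_pM2r //; lra.
have lkN : (2 * l * k <= n.+1)%N.
  by rewrite -(ler_nat R) -[leRHS]mul1r -ler_pdivrMr.
have step x : th * pr (P n) [set w | Q x (G n s w)] <= pr (P n) [set w | Q x (G n t w)].
  have pk c : p c -> (c <= k)%N by case/andP=> _ /ltnW.
  have lkN' : (l * k <= n.+1)%N by apply: leq_trans lkN; rewrite -mulnA mul2n -addnn leq_addr.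
  have := pr_gcomp_survive (F_sigma n) (F_meas (n := n)) (F_filt (n := n)) (@F_v n)
    (@v_unif n) (@F_E n) (@E_edges n) (floorn s n.+1) j x pk lkN'.
  rewrite js; apply: le_trans; rewrite ler_wpM2r ?pr_ge0 //.
  set u := (l * k)%:R / N n.
  have u2 : 2 * u = (2 * l * k)%:R / N n by rewrite /u -mulnA (natrM _ 2) mulrA.
  apply: le_trans (expR_le_exprB1 j _ _).
  - rewrite ler_expR lerN2 u2.
    apply: (@le_trans _ _ ((2 * l * k)%:R / N n * ((t - s) * N n + 1))).
      by rewrite ler_wpM2l // divr_ge0.
    rewrite mulrDr mulr1 lerD // [(t - s) * _]mulrC mulrA divfK //.
  - by rewrite divr_ge0.
  - by move: nlk; rewrite -u2; move: (u) => y; lra.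
have : th * ((D s - 3 * (e / 6)) * N n) <= (D t + 3 * (e / 6)) * N n.
  apply: le_trans upper; apply: le_trans (ler_wpM2l th0 lower) _.
  by rewrite mulr_sumr; apply: ler_sum => x _; exact: step.
rewrite mulrA ler_pM2r //; rewrite -/(D s) -/(D t).
by move: (D s) (D t) => x y; nra.
Qed.

(** * The limiting function and its continuity *)

Definition giant t : R := 1 - limn (density^~ t).

Lemma density_cvg t : 0 <= t -> density^~ t @ \oo --> 1 - giant t.
Proof.
move=> t0; rewrite /giant subKr; apply: nondecreasing_is_cvgn; first exact: density_homo.
by exists 1 => _ [K _ <-]; exact: density_le1.
Qed.

Lemma density_le_giant K t : 0 <= t -> density K t <= 1 - giant t.
Proof.
move=> t0; rewrite /giant subKr; apply: (nondecreasing_cvgn_le (density_homo t0)).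
by apply/cvg_ex; exists (1 - giant t); exact: density_cvg.
Qed.

Lemma giant_le_density t e : 0 <= t -> 0 < e ->
  exists K, forall K', (K <= K')%N -> 1 - density K' t <= giant t + e.
Proof.
move=> t0 e0; have /cvgrPdist_le/(_ e e0)[K _ HK] := density_cvg t0.
by exists K => K' /HK /=; rewrite ler_distlC => /andP[h1 h2]; lra.
Qed.

Lemma giant_ge t c : 0 <= t -> (forall K, density K t <= c) -> 1 - c <= giant t.
Proof.
move=> t0 hc; rewrite lerD2l lerN2; apply: limr_le; last exact: nearW.
by apply/cvg_ex; exists (1 - giant t); exact: density_cvg.
Qed.

Lemma giant_ge0 t : 0 <= t -> 0 <= giant t.
Proof. by move=> t0; rewrite -(subrr 1); apply: giant_ge => // K; exact: density_le1. Qed.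

Lemma giant_le1 t : 0 <= t -> giant t <= 1.
Proof. by move=> t0; have := density_le_giant 0 t0; have := density_ge0 0 t0; lra. Qed.

Lemma giant_homo s t : 0 <= s -> s <= t -> giant s <= giant t.
Proof.
move=> s0 st; rewrite -[leLHS](subKr 1); apply: giant_ge => [|K]; first exact: le_trans st.
by apply: le_trans (density_le_giant K s0); apply: density_anti; rewrite s0.
Qed.

Lemma giant0 : giant 0 <= 0.
Proof.
suff : 1 <= density 2 0 by have := @density_le_giant 2 0 (lexx 0); lra.
apply/ler_addgt0Pr => e e0; apply: (@whp_const _ _ _ P).
apply: whp_impl (whp_density 2 (lexx 0) e0) => n w.
rewrite /floorn mul0r truncn0 Gproc0 small0 // divff ?pnatr_eq0 //.
by rewrite ler_distlC => /andP[]; lra.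
Qed.

(** For one [K] chosen at time [t], [1 - density K t] is close to [giant t]; it bounds [giant] from
    above at later times too, and is Lipschitz. *)
Lemma giant_right_continuous t e : 0 <= t -> 0 < e ->
  exists2 del, 0 < del & forall s, t <= s -> s <= t + del -> giant s <= giant t + e.
Proof.
move=> t0 e0; have e2 : 0 < e / 2 by rewrite divr_gt0.
have [K /(_ _ (leqnn K)) HK] := giant_le_density t0 e2.
(* The successor keeps the divisor positive when [K] is [0]. *)
have lK0 : 0 < (l * K).+1%:R :> R by rewrite ltr0n.
exists (e / 2 / (l * K).+1%:R); first by rewrite divr_gt0.
move=> s ts st; have s0 := le_trans t0 ts.
have h1 := density_le_giant K s0.
have h2 : density K t - density K s <= (l * K)%:R * (s - t).
  by apply: density_lipschitz; rewrite t0.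
have h3 : (l * K)%:R * (s - t) <= e / 2.
  apply: (@le_trans _ _ ((l * K).+1%:R * (s - t))).
    by rewrite ler_wpM2r ?subr_ge0 // ler_nat.
  by rewrite mulrC -ler_pdivlMr // lerBlDl.
lra.
Qed.

Lemma giant_left_continuous t e : 0 < t -> 0 < e ->
  exists s, [/\ 0 <= s, s < t & giant t - e <= giant s].
Proof.
move=> t0 e0; apply: contrapT => no; have t0' := ltW t0.
have jump s : 0 <= s -> s < t -> giant s < giant t - e.
  by move=> s0 st; rewrite ltNge; apply/negP => ge; apply: no; exists s.
have al : 0 < e / 4 <= 1.
  have := jump _ (lexx 0) t0; have := giant_ge0 (lexx 0); have := giant_le1 t0'.
  by move=> h1 h2 h3; apply/andP; split; lra.
have /andP[al0 _] := al.
have [C C0 HC] := density_grouping al.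
(* With [k = B * k'] and [t - s = 2 * C / k], the Lipschitz loss at [k'] is [2 * l * C / B], at most
   [e / 4]. *)
pose B := (Num.truncn (2 * l%:R * C / (e / 4))).+1.
have lB : 2 * l%:R * C <= e / 4 * B%:R.
  by rewrite -ler_pdivrMl // [leLHS]mulrC ltW // truncnS_gt.
(* The survival factor over time [2 * C / k] for components of fewer than [k] vertices; it does not
   depend on [k], so [K0] can be chosen after it. *)
pose beta := expR (- (4 * l%:R * C + 1)).
have be0 : 0 < beta * (e / 4) by rewrite mulr_gt0 // expR_gt0.
have [K0 HK0] := giant_le_density t0' be0.
(* The second argument makes [k] large enough for [s] to be nonnegative. *)
pose k' := maxn K0 (Num.truncn (2 * C / t)).+1; pose k := (B * k')%N.
have k'0 : (0 < k')%N by rewrite /k' leq_max orbT.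
have k0 : (0 < k)%N by rewrite muln_gt0.
have kR0 : 0 < k%:R :> R by rewrite ltr0n.
have k'R0 : 0 < k'%:R :> R by rewrite ltr0n.
have k'k : (k' <= k)%N by rewrite leq_pmull.
pose s := t - 2 * C / k%:R.
have s0 : 0 <= s.
  rewrite subr_ge0 ler_pdivrMr // -ler_pdivrMl // [leLHS]mulrC.
  apply: (@le_trans _ _ (Num.truncn (2 * C / t)).+1%:R); first by rewrite ltW // truncnS_gt.
  by rewrite ler_nat (leq_trans _ k'k) // leq_max leqnn orbT.
have Ck : 0 < C / k%:R by rewrite divr_gt0.
have sC : s + C / k%:R = t - C / k%:R by rewrite /s; ring.
have st : s <= t by rewrite gerBl divr_ge0 // ?mulr_ge0 ?ltW.
(* Grouping ends at [t - C / k], still strictly before [t], where [giant] lies more than [e] below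
   [giant t]. *)
have D1 : 1 - giant t + 3 * (e / 4) <= density k s.
  have := @giant_ge (s + C / k%:R) (density k s + e / 4).
  move=> /(_ (addr_ge0 s0 (ltW Ck)) (fun K => HC k K s k0 s0)) h1.
  have := jump (s + C / k%:R); rewrite addr_ge0 ?(ltW Ck) // {1}sC ltrBlDr ltrDl Ck.
  by move=> /(_ isT isT); lra.
have D2 : density k' s <= 1 - giant t + e / 4.
  have h1 : density k' s - density k' t <= (l * k')%:R * (t - s).
    by apply: density_lipschitz; rewrite s0.
  have h2 := density_le_giant k' t0'.
  have h3 : (l * k')%:R * (t - s) <= e / 4.
    rewrite /s subKr mulrA ler_pdivrMr // /k !natrM.
    by have := ler_wpM2r (ltW k'R0) lB; lra.
  lra.
have := @density_survival k k' s t k'k; rewrite s0 st => /(_ isT).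
have -> : (2 * l * k)%:R * (t - s) = 4 * l%:R * C :> R.
  rewrite /s subKr (natrM _ (2 * l)) (natrM _ 2) mulrCA mulrA -[_ / _]mulrA.
  by rewrite mulfK ?gt_eqF //; ring.
rewrite -/beta => D3.
have D4 := density_le_giant k t0'.
have D5 : 1 - density k' t <= giant t + beta * (e / 4) by apply: HK0; rewrite leq_maxl.
(* Mass at least [2 * (e / 4)] lies in sizes [[k', k)] at time [s], so [beta] times it remains at
   [t], where the choice of [K0] allows only [beta * (e / 4)]. *)
have : beta * (2 * (e / 4)) <= beta * (density k s - density k' s).
  by rewrite ler_pM2l ?expR_gt0 //; lra.
move=> /le_trans/(_ D3); rewrite mulrCA.
by move: be0 D5; move: (beta * _) => z; lra.
Qed.

(** * Global convergence *)

Lemma whp_L1_le t e : 0 <= t -> 0 < e ->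
  whp P (fun n w => (L1 (G n t w))%:R / N n <= giant t + e).
Proof.
move=> t0 e0; have e2 : 0 < e / 2 by rewrite divr_gt0.
have [K /(_ _ (leqnSn K)) HK] := giant_le_density t0 e2.
apply: whp_impl (whp_and (whp_near P (near_div_le K.+1%:R e0)) (whp_density K.+1 t0 e2)).
move=> n w [nK]; have N0 : 0 < N n by rewrite ltr0n.
(* Either the largest component has bounded size, negligible against [n.+1], or it is disjoint from
   the vertices counted by [small]. *)
have [L1K _|KL1] := leqP (L1 (G n t w)) K.
  apply: (@le_trans _ _ (K.+1%:R / N n)); first by rewrite ler_wpM2r ?invr_ge0 // ler_nat leqW.
  by apply: le_trans nK _; rewrite lerDr giant_ge0.
have : (L1 (G n t w))%:R / N n + (small (G n t w) K.+1)%:R / N n <= 1.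
  by rewrite -mulrDl ler_pdivrMr // mul1r -natrD ler_nat L1_small.
rewrite ler_distlC; move: (_ / N n) (_ / N n) => x y h /andP[h1 h2]; lra.
Qed.

(** A union bound over the quadratically many pairs of vertices, each failing with exponentially
    small probability. *)
Lemma whp_merged (a t gam : R) : 0 < a <= 1 -> 0 <= t -> 0 < gam ->
  whp P (fun n w => forall x y, both_large a (G n t w) x y -> gconn (G n (t + gam) w) x y).
Proof.
move=> a01 t0 gam0; have /andP[a0 a1] := a01.
have tg : 0 <= t <= t + gam by rewrite t0 lerDl ltW.
pose bad n (xy : 'I_n.+1 * 'I_n.+1) (g h : {set 'I_n.+1 * 'I_n.+1}) :=
  both_large a g xy.1 xy.2 && ~~ gconn h xy.1 xy.2.
pose B n := [set w | [exists xy, bad n xy (G n t w) (G n (t + gam) w)]].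
have m2 n := measurable_Gproc2 (F_sigma n) (F_meas (n := n)) (F_filt (n := n)) (@F_E n).
have mB n : measurable (B n) by exact: (m2 n _ _ (fun g h => [exists xy, bad n xy g h])).
pose c := a ^+ l; have c0 : 0 < c by rewrite exprn_gt0.
have c1 : c <= 1 by rewrite exprn_ile1 // ltW.
suff prB : \forall n \near \oo, pr (P n) (B n) <= expR c * (3 / (c * gam)) ^+ 3 / N n.
  apply: whp_impl (whp_not mB prB) => n w nB x y large.
  apply: contrapT => /negP nc; apply: nB; apply/fintype.existsP; exists (x, y).
  by rewrite /bad /= large.
apply: nearW => n; have N0 : 0 < N n by rewrite ltr0n.
have [j js /andP[jl _]] := floorn_gap n.+1 tg.
apply: (@le_trans _ _ (\sum_(xy : 'I_n.+1 * 'I_n.+1) (1 - c) ^+ j)).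
  apply: (@le_trans _ _ (\sum_(xy <- index_enum _)
    pr (P n) [set w | bad n xy (G n t w) (G n (t + gam) w)])).
    apply: pr_union_bound; [exact: mB | by move=> xy; exact: (m2 n _ _ (bad n xy)) |].
    move=> w /fintype.existsP[xy bxy].
    by exists xy => //; rewrite mem_index_enum.
  apply: ler_sum => -[x y] _.
  have := pr_unmerged (F_sigma n) (F_meas (n := n)) (F_filt (n := n)) (@F_E n)
    (fun e e0 m => @merge e e0 n m) (floorn t n.+1) j x y a01.
  by rewrite js.
rewrite sumr_const card_prod card_ord -[leLHS]mulr_natr.
(* Writing the decay as a cube gives order [n.+1] to the power [-3], which beats the number of pairs
   and leaves the rate [M / n.+1]. *)
apply: (@le_trans _ _ (expR c * ((c * gam * N n / 3)^-1) ^+ 3 * (n.+1 * n.+1)%:R)); last first.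
  rewrite natrM le_eqVlt; apply/orP; left; apply/eqP; field.
  by rewrite !gt_eqF.
rewrite ler_wpM2r //; apply: le_trans (exprB1_le_expR j c1) _.
apply: (@le_trans _ _ (expR (c - 3 * (c * gam * N n / 3)))).
  rewrite ler_expR; have := ler_wpM2l (ltW c0) jl; rewrite addrAC subrr add0r.
  lra.
rewrite expRD -mulrN (expRM_natl 3) ler_wpM2l ?expR_ge0 //.
rewrite lerXn2r ?nnegrE ?expR_ge0 ?invr_ge0 ?divr_ge0 ?mulr_ge0 ?(ltW c0) ?(ltW gam0) //.
by apply: expRN_le_inv; rewrite divr_gt0 // !mulr_gt0.
Qed.

(** The first half of the time [gam] is used for grouping, the second for merging the resulting
    linear components into one. *)
Lemma whp_L1_ge t gam e : 0 <= t -> 0 < gam -> 0 < e <= 1 ->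
  whp P (fun n w => giant t - e <= (L1 (G n (t + gam) w))%:R / N n).
Proof.
move=> t0 gam0 /andP[e0 e1]; have e3 : 0 < e / 3 by rewrite divr_gt0.
have e31 : 0 < e / 3 <= 1 by apply/andP; split; lra.
have g2 : 0 < gam / 2 by rewrite divr_gt0.
have [C C0] := whp_grouping e31; set b := _ / (2 * l.+1)%:R => HC.
have b0 : 0 < b by rewrite divr_gt0 // ltr0n.
have b1 : 0 < b <= 1.
  rewrite b0 ler_pdivrMr ?ltr0n // mul1r; apply: le_trans (_ : 1 <= _); first by lra.
  by rewrite ler1n.
pose k := (Num.truncn (C / (gam / 2))).+1.
have kR0 : 0 < k%:R :> R by rewrite ltr0n.
have kC : C / k%:R <= gam / 2.
  by rewrite ler_pdivrMr // -ler_pdivrMl // [leLHS]mulrC ltW // truncnS_gt.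
have t1 : 0 <= t + gam / 2 by rewrite addr_ge0 // ltW.
have := whp_and (whp_density k t0 e3) (whp_and (HC k t _ (ltn0Sn _) t0 kC) (whp_merged b1 t1 g2)).
have -> : t + gam / 2 + gam / 2 = t + gam by field.
apply: whp_impl => n w [dk [st mg]].
have N0 : 0 < N n by rewrite ltr0n.
set q := floorn b n.+1 in st; set g1 := G n (t + gam / 2) w in st mg.
set g2' := G n (t + gam) w in mg *.
have big : (n.+1 <= L1 g2' + small g1 q.+1)%N.
  have large x : (q < #|gcomp g1 x|)%N -> b * N n <= #|gcomp g1 x|%:R.
    by move=> qx; apply: le_trans (ltW (truncnS_gt _)) _; rewrite ler_nat.
  rewrite -[X in (X <= _)%N](card_ord n.+1) -(cardsC [set x | #|gcomp g1 x| < q.+1]%N%SET).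
  (* All vertices of [H] lie in linear components at the middle time, so at the end they share the
     component of any one of them. *)
  rewrite addnC leq_add2r; set H := (~: _)%SET.
  have [->|/set0Pn[x xH]] := eqVneq H finset.set0; first by rewrite cards0.
  apply: leq_trans (gcomp_le_L1 g2' x); apply: fintype.subset_leq_card.
  apply/fintype.subsetP => y yH; rewrite mem_gcomp; apply: mg.
  by move: xH yH; rewrite !inE -!ltnNge !ltnS => /large xH /large yH; apply/andP.
have h1 : 1 <= (L1 g2')%:R / N n + (small (G n t w) k)%:R / N n + e / 3.
  rewrite -(ler_pM2r N0) mul1r !mulrDl !divfK ?gt_eqF //.
  apply: le_trans (_ : (L1 g2' + small g1 q.+1)%:R <= _); first by rewrite ler_nat.
  rewrite natrD -addrA lerD2l.
  apply: le_trans (_ : (small (G n t w) k + stuck (G n t w) g1 k q)%:R <= _).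
    by rewrite ler_nat small_le_stuck.
  by rewrite natrD lerD2l.
have h2 := density_le_giant k t0.
move: dk h1; rewrite ler_distlC; move: (_ / N n) (_ / N n) => x y /andP[h3 h4]; lra.
Qed.

Lemma giant_globally_convergent : globally_convergent_to P E giant.
Proof.
split; first by move=> t t0; rewrite giant_ge0 // giant_le1.
split; first exact: giant_homo.
move=> t t0 _; apply: whp_cvg_in_prob => [e n|e e0].
  exact: (@mG n (floorn t n.+1) (fun g => e < `|(L1 g)%:R / N n - giant t|)).
have lower : whp P (fun n w => giant t - e <= (L1 (G n t w))%:R / N n).
  (* No earlier time is available at [0], but there [giant] is at most [0]. *)
  have [<-|t_neq0] := eqVneq 0 t.
    by apply: whp_sure => n w; apply: (@le_trans _ _ 0);
      [have := giant0; lra | rewrite divr_ge0].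
  (* Half of [e] goes to left continuity and half to the bound on [L1], which also requires an error
     of at most [1]. *)
  pose e' := Num.min (e / 2) 1.
  have e'0 : 0 < e' by rewrite lt_min divr_gt0 //=.
  have tpos : 0 < t by rewrite lt_neqAle t_neq0.
  have [s [s0 st hs]] := giant_left_continuous tpos e'0.
  have e'1 : 0 < e' <= 1 by rewrite e'0 ge_min lexx orbT.
  have ts : 0 < t - s by rewrite subr_gt0.
  have := whp_L1_ge s0 ts e'1; rewrite subrKC; apply: whp_impl => n w.
  apply: le_trans; have : e' <= e / 2 by rewrite ge_min lexx.
  lra.
apply: whp_impl (whp_and lower (whp_L1_le t0 e0)) => n w [h1 h2].
by rewrite ler_distl h1.
Qed.

Lemma giant_continuous : {within `[0, +oo[, continuous giant}.
Proof.
apply/continuous_within_itvcyP; split=> [t|].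
  rewrite in_itv /= andbT => t0; have t0' := ltW t0.
  apply/cvgrPdist_le => e e0.
  have [del del0 hr] := giant_right_continuous t0' e0.
  have [s [s0 st hs]] := giant_left_continuous t0 e0.
  have lo : \forall x \near t, s < x by exact: lt_nbhsr.
  have hi : \forall x \near t, x < t + del by apply: lt_nbhsl; rewrite ltrDl.
  apply: filterS2 lo hi => x sx xt; rewrite ler_distlC.
  have x0 := le_trans s0 (ltW sx); have := giant_homo s0 (ltW sx).
  have [tx|xt'] := leP t x.
    by have := hr x tx (ltW xt); have := giant_homo t0' tx; lra.
  by have := giant_homo x0 (ltW xt'); lra.
apply/cvgrPdist_le => e e0.
have [del del0 hr] := giant_right_continuous (lexx 0) e0.
have lo : \forall x \near 0^'+, (0 : R) < x by exact: nbhs_right_gt.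
have hi : \forall x \near 0^'+, x < del by exact: nbhs_right_lt.
apply: filterS2 lo hi => x x0 xd; rewrite ler_distlC.
have := giant_homo (lexx 0) (ltW x0); have := hr x (ltW x0).
by rewrite add0r (ltW xd) => /(_ isT); lra.
Qed.

End ComponentDensities.

Theorem theorem3 (R : realType) (l : nat) (hl : (2 <= l)%N)
  (d : measure_display) (T : nat -> measurableType d)
  (P : forall n, probability (T n) R)
  (F : forall n, nat -> set (set (T n)))
  (v : forall n, nat -> T n -> {ffun 'I_l -> 'I_n.+1})
  (E : forall n, nat -> T n -> {set 'I_n.+1 * 'I_n.+1})
  (rho_ : nat -> R -> R) :
  is_vertex_rule P F v E ->
  is_merging l P F E ->
  locally_convergent P E rho_ ->
  exists rho : R -> R,
    [/\ globally_convergent_to P E rho,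
        {within `[0, +oo[, continuous rho} &
        forall t : R, 0 <= t ->
          (fun N => \sum_(1 <= k < N) rho_ k t) @ \oo --> 1 - rho t].
Proof.
move=> rule merge loc; exists (giant rho_); split.
- exact: giant_globally_convergent rule merge loc.
- exact: giant_continuous rule loc.
- move=> t; exact: density_cvg rule loc t.
Qed.
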